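(* Let $d\ge 2$ be an integer. For every pair of density matrices $\rho,\sigma\in\mathcal{D}(\mathbb{C}^d)$ and every $a\in[0,1]$: (i) $H(\rho\boxplus_a\sigma)\ge a H(\rho)+(1-a)H(\sigma)$; (ii) $e^{cH(\rho\boxplus_a\sigma)}\ge a\,e^{cH(\rho)}+(1-a)\,e^{cH(\sigma)}$ for every real $c$ with $0\le c\le 1/(\log d)^2$; (iii) $N_c(\rho\boxplus_a\sigma)\ge a N_c(\rho)+(1-a)N_c(\sigma)$ for every real $c$ with $0\le c\le 1/(d-1)$.
   Context: $\mathcal{D}(\mathbb{C}^d)$ is the set of $d\times d$ complex positive semidefinite matrices of trace $1$. $\log$ is the natural logarithm. $H(\rho):=-\operatorname{Tr}(\rho\log\rho)=-\sum_i\lambda_i\log\lambda_i$ is the von Neumann entropy ($\lambda_i$ the eigenvalues of $\rho$, $0\log0:=0$). Entropy photon number: $N_c(\rho):=g^{-1}(cH(\rho))$, where $g:[0,\infty)\to[0,\infty)$, $g(x):=(x+1)\log(x+1)-x\log x$ (with $g(0)=0$), a strictly increasing bijection with inverse $g^{-1}$. Addition rule: $\rho\boxplus_a\sigma:=a\rho+(1-a)\sigma-\sqrt{a(1-a)}\;i[\rho,\sigma]$, with $[\rho,\sigma]:=\rho\sigma-\sigma\rho$. This is again a density matrix: it equals $\operatorname{Tr}_2\big(U_a(\rho\otimes\sigma)U_a^\dagger\big)$, where $U_a=\sqrt a\,I+i\sqrt{1-a}\,S$ and $S$ is the swap operator on $\mathbb{C}^d\otimes\mathbb{C}^d$. *)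

(* Defs.v *)
From HB Require Import structures.
From mathcomp Require Import all_boot all_order all_algebra.
From mathcomp Require Import all_classical all_reals all_analysis.
From mathcomp Require Import complex.
Set Implicit Arguments.
Unset Strict Implicit.
Unset Printing Implicit Defensive.
Import Order.TTheory GRing.Theory Num.Theory.
Local Open Scope classical_set_scope.
Local Open Scope ring_scope.
Local Open Scope sesquilinear_scope.

(* The order on [R[i]] is the partial one: [0 <= z] means that [z] is real and
   nonnegative. *)
Definition psdmx (R : realType) (d : nat) (A : 'M[R[i]]_d) : Prop :=
  A \is hermsymmx /\ forall v : 'cV[R[i]]_d, 0 <= (v^t* *m A *m v) ord0 ord0.

Definition density (R : realType) (d : nat) (rho : 'M[R[i]]_d) : Prop :=
  psdmx rho /\ \tr rho = 1.

(* For a Hermitian matrix [rho], [spectral_diag rho] lists its (real)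
   eigenvalues with multiplicity. The convention 0 log 0 = 0 holds because
   [ln] is total. *)
Definition entropy (R : realType) (d : nat) (rho : 'M[R[i]]_d) : R :=
  - \sum_(i < d) (let l := complex.Re (spectral_diag rho ord0 i) in l * ln l).

Definition gfun (R : realType) (x : R) : R :=
  (x + 1) * ln (x + 1) - x * ln x.

(* [gfun] is a bijection of [0, +oo[ onto itself; the value of [ginv] outside
   [0, +oo[ is irrelevant. *)
Definition ginv (R : realType) : R -> R :=
  'pinv_(fun=> 0) `[0, +oo[ (@gfun R).

Definition photon_number (R : realType) (d : nat) (c : R)
    (rho : 'M[R[i]]_d) : R :=
  ginv (c * entropy rho).

Definition commutator (R : realType) (d : nat) (A B : 'M[R[i]]_d) :
    'M[R[i]]_d :=
  A *m B - B *m A.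

Definition qadd (R : realType) (d : nat) (a : R) (rho sigma : 'M[R[i]]_d) :
    'M[R[i]]_d :=
  a%:C%C *: rho + (1 - a)%:C%C *: sigma
  - ((Num.sqrt (a * (1 - a)))%:C%C * 'i%C) *: commutator rho sigma.

(* Main.v *)
Require Import Defs.
From mathcomp Require Import all_boot all_order all_algebra.
From mathcomp Require Import all_classical all_reals all_analysis.
From mathcomp Require Import complex.
From mathcomp Require Import perm ring lra.
Import Order.TTheory GRing.Theory Num.Theory.
Import numFieldNormedType.Exports.
Local Open Scope ring_scope.

Set Implicit Arguments.
Unset Strict Implicit.
Unset Printing Implicit Defensive.

(* The spectrum of [qadd a rho sigma] is majorized by the convex combination
   [a * p + (1 - a) * q] of the decreasingly ordered spectra of [rho] and
   [sigma]: for an orthogonal projector [P] of rank [k], the commutator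
   contributes at most [a |P rho P'|^2 + (1 - a) |P sigma P'|^2] to the trace
   against [P], where [P' = 1 - P], and [tr (P rho) + |P rho P'|^2] is still at
   most the sum of the [k] largest eigenvalues of the state [rho].  As the
   Shannon entropy [H] is Schur concave, it remains to see that [phi o H] is
   concave on the simplex for [phi x = x], [expR (c x)], [ginv (c x)].  By
   Cauchy-Schwarz this reduces to [phi'' (H p) * V p <= phi' (H p)], where [V]
   is the varentropy.  For the exponential one needs [V <= (ln d) ^ 2].  For
   [ginv], the varentropy of [p] is compared with that of a product of [d - 1]
   geometric distributions of total entropy at most [H p], using that the
   varentropy of a geometric distribution is a concave function of its entropy. *)

(** * Calculus on the real line *)

Section RealLemmas.
Context {R : realType}.
Implicit Types x y t : R.

Lemma xlnx_derive x : 0 < x -> is_derive x 1 (fun y : R => y * ln y) (ln x + 1).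
Proof.
move=> x0; have dl := is_derive1_ln x0.
apply: (@is_derive_eq _ _ _ (id * @ln R)).
by rewrite /GRing.scale /= mulfV ?gt_eqF// mulr1 addrC.
Qed.

(** From [ln z <= z - 1] at [z = (Num.sqrt x)^-1], doubling the logarithm; it gives an explicit
    modulus of continuity of [x * ln x] at 0. *)
Lemma xlnx_le_sqrt x : 0 < x -> - (x * ln x) <= 2 * Num.sqrt x.
Proof.
move=> x0; have s0 : 0 < Num.sqrt x by rewrite sqrtr_gt0.
have /(le_ln1Dx) : -1 < (Num.sqrt x)^-1 - 1.
  by have := s0; rewrite -invr_gt0; lra.
rewrite addrCA subrr addr0 lnV ?posrE// => h.
have hx : x = Num.sqrt x ^+ 2 by rewrite sqr_sqrtr// ltW.
rewrite {1 2}hx lnXn// mulr2n expr2.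
move: (Num.sqrt x) s0 h => s s0 h.
have : s * (s * - ln s) <= s * (s * (s^-1 - 1)).
  by rewrite !ler_pM2l.
rewrite mulrBr divff ?gt_eqF//; nra.
Qed.

Lemma xlnx_lt x (e : R) : 0 < e -> 0 < x -> x < (e / 2) ^+ 2 -> - (x * ln x) < e.
Proof.
move=> e0 x0 xe; apply: le_lt_trans (xlnx_le_sqrt x0) _.
rewrite mulrC -ltr_pdivlMr//.
by rewrite -ltr_sqrt ?exprn_gt0 ?divr_gt0// sqrtr_sqr ger0_norm ?divr_ge0 ?ltW// in xe.
Qed.

Lemma xlnx_continuous : continuous (fun x : R => x * ln x).
Proof.
move=> x; have [x0|x0|->] := ltrgtP x 0.
(* [ln] is 0 at nonpositive arguments, so the function is constant to the left of 0. *)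
- apply: (near_cst_continuous 0); near=> y.
  rewrite ln0 ?mulr0//; apply/ltW; near: y; exact: lt_nbhsl.
- by apply: continuousM; [exact: cvg_id | exact: continuous_ln].
- rewrite /continuous_at mul0r; apply/cvgr0Pnorm_lt => /= e e0; near=> y.
  have [y0|y0] := leP y 0; first by rewrite ln0// mulr0 normr0.
  have y1 : y < 1 by near: y; exact: lt_nbhsl.
  have ye : y < (e / 2) ^+ 2 by near: y; apply: lt_nbhsl; rewrite exprn_gt0// divr_gt0.
  have l0 : ln y <= 0 by rewrite ln_le0// ltW.
  rewrite /= ler0_norm; last by rewrite pmulr_rle0.
  exact: xlnx_lt.
Unshelve. all: by end_near. Qed.

Lemma mull_derive (c x : R) : is_derive x 1 (fun y : R => c * y) c.
Proof.
have h := is_deriveM (is_derive_cst c x (1 : R)) (is_derive_id x (1 : R)).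
by apply: (is_derive_eq h); rewrite /GRing.scale/= mulr0 addr0 mulr1.
Qed.

(** The mean value theorem on [[0, a]] and on [[a, 1]] gives two slopes, and applied to [f1] between
    them shows that they decrease. Derivatives are asked only inside the interval, since the entropy
    may have infinite slope at the ends. *)
Lemma concave_of_derive2 (f f1 f2 : R -> R) (a : R) :
  continuous f ->
  (forall t, 0 < t < 1 -> is_derive t 1 f (f1 t)) ->
  (forall t, 0 < t < 1 -> is_derive t 1 f1 (f2 t)) ->
  (forall t, 0 < t < 1 -> f2 t <= 0) ->
  0 <= a <= 1 -> a * f 1 + (1 - a) * f 0 <= f a.
Proof.
move=> cf df df1 f20 /andP[]; rewrite le_eqVlt => /predU1P[<- _|a0].
  by rewrite mul0r add0r subr0 mul1r.
rewrite le_eqVlt => /predU1P[->|a1].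
  by rewrite mul1r subrr mul0r addr0.
have cw (g : R -> R) (u v : R) : continuous g -> {within `[u, v], continuous g}%classic.
  exact: continuous_subspaceT.
have da c : c \in `]0, a[ -> is_derive c 1 f (f1 c).
  by rewrite in_itv/= => /andP[c0 ca]; apply: df; rewrite c0 (lt_trans ca).
have db c : c \in `]a, 1[ -> is_derive c 1 f (f1 c).
  by rewrite in_itv/= => /andP[c0 ca]; apply: df; rewrite ca (lt_trans a0).
have [c1] := MVT a0 da (cw f 0 a cf).
rewrite in_itv/= => /andP[c10 c1a] e1.
have [c2] := MVT a1 db (cw f a 1 cf).
rewrite in_itv/= => /andP[c2a c21] e2.
have c12 : c1 < c2 by exact: lt_trans c2a.
have d1 t : t \in `[c1, c2] -> is_derive t 1 f1 (f2 t).
  by rewrite in_itv/= => /andP[? ?]; apply: df1; rewrite (lt_le_trans c10)// (le_lt_trans _ c21).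
have d1o t : t \in `]c1, c2[ -> is_derive t 1 f1 (f2 t).
  by rewrite in_itv/= => /andP[? ?]; apply: d1; rewrite in_itv/= !ltW.
have cf1 : {within `[c1, c2], continuous f1}%classic.
  by apply: derivable_within_continuous => t /d1[].
have [c] := MVT c12 d1o cf1.
rewrite in_itv/= => /andP[cc1 cc2] e3.
have : f2 c * (c2 - c1) <= 0.
  rewrite pmulr_lle0 ?subr_gt0// f20// (lt_trans c10)//=; exact: lt_trans c21.
rewrite -e3 subr_le0 => h; move: e1 e2; rewrite subr0 => e1 e2.
have : 0 <= (f1 c1 - f1 c2) * (a * (1 - a)) by rewrite mulr_ge0 ?mulr_ge0 ?subr_ge0// ltW.
by nra.
Qed.

Lemma derive_ge0_le (f f1 : R -> R) (a b : R) : a <= b ->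
  (forall x : R, a <= x <= b -> is_derive x 1 f (f1 x)) ->
  (forall x : R, a <= x <= b -> 0 <= f1 x) -> f a <= f b.
Proof.
move=> ab df f10.
have d1 x : x \in `]a, b[ -> is_derive x 1 f (f1 x).
  by rewrite in_itv/= => /andP[? ?]; apply: df; rewrite !ltW.
have cf : {within `[a, b], continuous f}%classic.
  by apply: derivable_within_continuous => t; rewrite in_itv/= => /df[].
have [c] := MVT_segment ab d1 cf.
rewrite in_itv/= => /f10 h e; rewrite -subr_ge0 e mulr_ge0// subr_ge0//.
Qed.

(** [q] is the derivative of [k] and is itself nondecreasing, as its derivative is
    [expR y - (1 + y)]; it vanishes at 0, so [k] is least there. The odd degree makes the bound
    valid for negative [x] too. *)
Lemma expR_cubic_le x : 1 + x + x ^+ 2 / 2 + x ^+ 3 / 6 <= expR x.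
Proof.
pose q x := expR x - (1 + x + x ^+ 2 / 2).
pose k x := expR x - (1 + x + x ^+ 2 / 2 + x ^+ 3 / 6).
have dX n (y : R) : is_derive y 1 (fun z : R => z ^+ n) (n%:R * y ^+ n.-1).
  have h := is_deriveX n (is_derive_id y (1 : R)).
  rewrite (_ : (fun z => z ^+ n) = id ^+ n); last by apply/funext => z; rewrite exprfctE.
  by apply: (is_derive_eq h); rewrite /GRing.scale/= mulr1.
have dq (y : R) : is_derive y 1 q (expR y - (1 + y)).
  have h := is_deriveB (is_derive_expR y) (is_deriveD (is_deriveD
    (is_derive_cst (1 : R) y 1) (is_derive_id y 1)) (is_deriveM (dX 2%N y) (is_derive_cst (2^-1 : R) y 1))).
  by apply: (is_derive_eq h); rewrite /GRing.scale/=; field.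
have dk (y : R) : is_derive y 1 k (q y).
  have h := is_deriveB (is_derive_expR y) (is_deriveD (is_deriveD (is_deriveD
    (is_derive_cst (1 : R) y 1) (is_derive_id y 1)) (is_deriveM (dX 2%N y) (is_derive_cst (2^-1 : R) y 1)))
    (is_deriveM (dX 3%N y) (is_derive_cst (6^-1 : R) y 1))).
  by apply: (is_derive_eq h); rewrite /GRing.scale/= /q; field.
have q0 : q 0 = 0 by rewrite /q expR0; ring.
have k0 : k 0 = 0 by rewrite /k expR0; ring.
have hq y : 0 <= expR y - (1 + y) by rewrite subr_ge0 expR_ge1Dx.
rewrite -subr_ge0 -/(k x) -k0; have [x0|x0] := leP 0 x.
  apply: (derive_ge0_le x0 (fun y _ => dk y)) => y /andP[y0 _].
  by rewrite -q0; exact: (derive_ge0_le y0 (fun z _ => dq z)).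
have dNk (y : R) : is_derive y 1 (fun z => - k z) (- q y) by exact: is_deriveN.
rewrite -lerN2; apply: (derive_ge0_le (ltW x0) (fun y _ => dNk y)) => y.
move=> /andP[_ y0]; rewrite oppr_ge0 -q0.
exact: (derive_ge0_le y0 (fun z _ => dq z)).
Qed.

End RealLemmas.

(** * Concave functions of the Shannon entropy *)

Section Shannon.
Context {R : realType} {d : nat}.
Implicit Types p q v : 'I_d -> R.

Definition prob p := (forall i, 0 <= p i) /\ \sum_i p i = 1.

Definition shannon p := - \sum_i p i * ln (p i).

(** The variance of [- ln (p i)] for [i] drawn from [p]; its mean is [shannon p]. *)
Definition varentropy p := \sum_i p i * (ln (p i) + shannon p) ^+ 2.

Lemma prob_le1 p i : prob p -> p i <= 1.
Proof.
move=> [p0 <-]; rewrite (bigD1 i)//= lerDl; exact: sumr_ge0.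
Qed.

Lemma prob_conv p q (a : R) : 0 <= a <= 1 -> prob p -> prob q ->
  prob (fun i => a * p i + (1 - a) * q i).
Proof.
move=> /andP[a0 a1] [p0 p1] [q0 q1]; split=> [i|].
  by rewrite addr_ge0 ?mulr_ge0// subr_ge0.
by rewrite big_split/= -!mulr_sumr p1 q1 !mulr1 addrC subrK.
Qed.

Lemma xlnx_le0 (x : R) : x <= 1 -> x * ln x <= 0.
Proof.
move=> x1; have [x0|x0] := leP x 0; first by rewrite ln0// mulr0.
by rewrite pmulr_rle0// ln_le0.
Qed.

Lemma shannon_ge0 p : prob p -> 0 <= shannon p.
Proof.
move=> pp; rewrite oppr_ge0; apply: sumr_le0 => i _.
by apply: xlnx_le0; exact: prob_le1.
Qed.

Lemma shannon_gt0 p i : prob p -> 0 < p i < 1 -> 0 < shannon p.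
Proof.
move=> pp /andP[p0 p1]; rewrite oppr_gt0 (bigD1 i)//=.
have h : p i * ln (p i) < 0 by rewrite pmulr_rlt0// ln_lt0 ?p0.
have := @sumr_le0 R _ (index_enum 'I_d) (predC1 i) (fun j => p j * ln (p j)).
move=> /(_ (fun j _ => xlnx_le0 (prob_le1 j pp))) h2.
by rewrite (lt_le_trans _ (lexx 0))// -[X in _ < X]addr0 ltr_leD.
Qed.

(* Cauchy-Schwarz for the weights [p]; the terms with [p i = 0] drop out. *)
Lemma entropy_slope_sqr_le p v : prob p -> \sum_i v i = 0 ->
  (forall i, p i = 0 -> v i = 0) ->
  (\sum_i v i * ln (p i)) ^+ 2 <= varentropy p * \sum_i v i ^+ 2 / p i.
Proof.
move=> [p0 p1] v0 pv.
pose y i := ln (p i) + shannon p.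
have -> : \sum_i v i * ln (p i) = \sum_i v i * y i.
  rewrite /y; under [RHS]eq_bigr do rewrite mulrDr.
  by rewrite big_split/= -mulr_suml v0 mul0r addr0.
set T := \sum_i _; set V := varentropy p; set S := \sum_i _.
have S0 : 0 <= S by apply: sumr_ge0 => i _; rewrite mulr_ge0 ?sqr_ge0 ?invr_ge0.
(* Expanding the [p]-weighted squares of [v i / p i + k * y i] gives a quadratic in [k] that is
   never negative; its discriminant is the claim. *)
have key (k : R) : 0 <= S + 2 * k * T + k ^+ 2 * V.
  suff <- : \sum_i (p i * (v i / p i + k * y i) ^+ 2) = S + 2 * k * T + k ^+ 2 * V.
    by apply: sumr_ge0 => i _; rewrite mulr_ge0 ?sqr_ge0.
  rewrite /S /T /V /varentropy !mulr_sumr -!big_split/=; apply: eq_bigr => i _.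
  have [e|n0] := eqVneq (p i) 0; first by rewrite e (pv _ e); ring.
  by rewrite /y; field.
have V0 : 0 <= V by apply: sumr_ge0 => i _; rewrite mulr_ge0 ?sqr_ge0.
have [e|Vn0] := eqVneq V 0.
  rewrite e mul0r; have [->|Tn0] := eqVneq T 0; first by rewrite expr0n.
  (* For [V = 0] the quadratic is affine in [k], and this [k] makes it [-1]. *)
  have := key (- (S + 1) / (2 * T)); rewrite e.
  have -> : S + 2 * (- (S + 1) / (2 * T)) * T + (- (S + 1) / (2 * T)) ^+ 2 * 0 = -1.
    by field.
  by lra.
have := key (- T / V).
have -> : S + 2 * (- T / V) * T + (- T / V) ^+ 2 * V = S - T ^+ 2 / V by field.
by rewrite subr_ge0 ler_pdivrMr ?lt_def ?Vn0// mulrC.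
Qed.

Lemma affine_derive (a b t : R) : is_derive t 1 (fun s => a + s * b) b.
Proof.
have h := is_deriveD (is_derive_cst a t 1) (is_deriveM (is_derive_id t 1) (is_derive_cst b t 1)).
apply: (is_derive_eq h).
by rewrite /GRing.scale/= mulr0 mulr1 !add0r.
Qed.

Lemma xlnx_affine_derive (a b t : R) : 0 < a + t * b ->
  is_derive t 1 (fun s => (a + s * b) * ln (a + s * b)) (b * (ln (a + t * b) + 1)).
Proof.
move=> h; rewrite mulrC.
exact: (@is_derive1_comp _ (fun y => y * ln y) (fun s => a + s * b) _ _ _ (xlnx_derive h) (affine_derive a b t)).
Qed.

Lemma ln_affine_derive (a b t : R) : 0 < a + t * b ->
  is_derive t 1 (fun s => b * (ln (a + s * b) + 1)) (b ^+ 2 / (a + t * b)).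
Proof.
move=> h.
have dl := @is_derive1_comp _ (@ln R) (fun s => a + s * b) _ _ _ (is_derive1_ln h) (affine_derive a b t).
have h1 := is_deriveM (is_derive_cst b t 1) (is_deriveD dl (is_derive_cst (1 : R) t 1)).
apply: (is_derive_eq h1).
by rewrite /GRing.scale/= mulr0 !addr0 expr2 mulrA mulrAC.
Qed.

(** Termwise differentiation; the second alternative covers the coordinates that vanish along the
    whole line, where the summand is constantly 0. *)
Lemma shannon_line_derive p v (t : R) :
  (forall i, 0 < p i + t * v i \/ p i = 0 /\ v i = 0) ->
  is_derive t 1 (fun s => shannon (fun i => p i + s * v i))
    (- \sum_i v i * (ln (p i + t * v i) + 1)) /\
  is_derive t 1 (fun s => - \sum_i v i * (ln (p i + s * v i) + 1))
    (- \sum_i v i ^+ 2 / (p i + t * v i)).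
Proof.
move=> h; split.
  have -> : (fun s => shannon (fun i => p i + s * v i)) =
      - \sum_i (fun s => (p i + s * v i) * ln (p i + s * v i)).
    by apply/funext => s; rewrite opprfctE fct_sumE.
  apply: is_deriveN; apply: is_derive_sum => i.
  have [|[-> ->]] := h i; first exact: xlnx_affine_derive.
  rewrite mul0r (_ : (fun _ => _) = cst 0); first exact: is_derive_cst.
  by apply/funext => s; rewrite mulr0 addr0 mul0r.
have -> : (fun s => - \sum_i v i * (ln (p i + s * v i) + 1)) =
      - \sum_i (fun s => v i * (ln (p i + s * v i) + 1)).
  by apply/funext => s; rewrite opprfctE fct_sumE.
apply: is_deriveN; apply: is_derive_sum => i.
have [|[-> ->]] := h i; first exact: ln_affine_derive.
rewrite expr0n mul0r (_ : (fun _ => _) = cst 0); first exact: is_derive_cst.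
by apply/funext => s; rewrite mul0r.
Qed.

Lemma shannon_line_continuous p v :
  continuous (fun s : R => shannon (fun i => p i + s * v i)).
Proof.
have -> : (fun s => shannon (fun i => p i + s * v i)) =
      - \sum_i (fun s => (p i + s * v i) * ln (p i + s * v i)).
  by apply/funext => s; rewrite opprfctE fct_sumE.
move=> s; apply: continuousN; move: s.
change (continuous (\sum_i (fun s : R => (p i + s * v i) * ln (p i + s * v i)))).
apply: (big_ind (fun f : R -> R => continuous f)) => [|f g cf cg s|i _ s].
- exact: cst_continuous.
- exact: (continuousD (cf s) (cg s)).
- have ca : {for s, continuous (fun s : R => p i + s * v i)}.
    by apply: differentiable_continuous; apply/derivable1_diffP; case: (affine_derive (p i) (v i) s).
  exact: (continuous_comp ca (@xlnx_continuous R _)).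
Qed.

(** Along the segment from [q] to [p] the second derivative is [phi2 H * D ^+ 2 + phi1 H * D2].
    Cauchy-Schwarz gives [D ^+ 2 <= V * - D2], with [V] the varentropy, so the assumed bound on
    [phi2 * V] makes the sum nonpositive. *)
Lemma shannon_comp_concave (phi phi1 phi2 : R -> R) p q (a : R) :
  continuous phi ->
  (forall x : R, 0 < x -> is_derive x 1 phi (phi1 x)) ->
  (forall x : R, 0 < x -> is_derive x 1 phi1 (phi2 x)) ->
  (forall x : R, 0 < x -> 0 <= phi1 x) ->
  (forall r, prob r -> 0 < shannon r ->
    phi2 (shannon r) * varentropy r <= phi1 (shannon r)) ->
  prob p -> prob q -> 0 <= a <= 1 ->
  a * phi (shannon p) + (1 - a) * phi (shannon q) <=
  phi (shannon (fun i => a * p i + (1 - a) * q i)).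
Proof.
move=> cphi dphi dphi1 phi1_ge0 hV pp pq a01.
have [epq|/existsNP[j /eqP neqj]] := pselect (p =1 q).
  have -> : (fun i => a * p i + (1 - a) * q i) = q.
    by apply/funext => i; rewrite epq -mulrDl addrC subrK mul1r.
  have -> : p = q by apply/funext.
  by rewrite -mulrDl addrC subrK mul1r.
pose v i := p i - q i; pose r t i := q i + t * v i.
have rE t i : r t i = t * p i + (1 - t) * q i by rewrite /r /v; ring.
have v0 : \sum_i v i = 0 by rewrite sumrB pp.2 pq.2 subrr.
have pr (t : R) : 0 <= t <= 1 -> prob (r t).
  by move=> t01; rewrite (_ : r t = fun i => t * p i + (1 - t) * q i); [exact: prob_conv | exact/funext].
have rpos (t : R) i : 0 < t < 1 -> 0 < r t i \/ q i = 0 /\ v i = 0.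
  move=> /andP[t0 t1]; rewrite rE.
  have [p0|p0] := ltP 0 (p i).
    by left; rewrite ltr_pwDl ?mulr_gt0// mulr_ge0 ?pq.1// subr_ge0 ltW.
  have [q0|q0] := ltP 0 (q i).
    by left; rewrite ltr_wpDl ?mulr_gt0 ?subr_gt0// mulr_ge0 ?pp.1// ltW.
  right; have ep : p i = 0 by apply/le_anti; rewrite p0 pp.1.
  have eq : q i = 0 by apply/le_anti; rewrite q0 pq.1.
  by rewrite /v ep eq subrr.
(* Inside the segment, the coordinate [j] at which [p] and [q] differ lies strictly between 0 and 1,
   which keeps the entropy where [phi] is differentiable. *)
have H0 (t : R) : 0 < t < 1 -> 0 < shannon (r t).
  move=> t01; have /andP[t0 t1] := t01.
  apply: (@shannon_gt0 _ j); first by apply: pr; rewrite !ltW.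
  rewrite rE; have := pp.1 j; have := pq.1 j; have := prob_le1 j pp; have := prob_le1 j pq.
  move: neqj; rewrite neq_lt => /orP[] h *; apply/andP; split; nra.
pose H t := shannon (r t).
pose D t := - \sum_i v i * (ln (r t i) + 1).
pose D2 t := - \sum_i v i ^+ 2 / r t i.
have dH (t : R) : 0 < t < 1 -> is_derive t 1 H (D t) /\ is_derive t 1 D (D2 t).
  by move=> t01; apply: shannon_line_derive => i; exact: rpos.
have := @concave_of_derive2 R (fun t => phi (H t)) (fun t => phi1 (H t) * D t)
  (fun t => phi2 (H t) * D t ^+ 2 + phi1 (H t) * D2 t) a.
rewrite /H (_ : r 1 = p); last by apply/funext => i; rewrite rE; ring.
rewrite (_ : r 0 = q); last by apply/funext => i; rewrite rE; ring.
rewrite (_ : r a = fun i => a * p i + (1 - a) * q i); last by apply/funext => i; rewrite rE.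
apply=> [t|t t01|t t01|t t01|//].
- have cH : {for t, continuous H} by exact: shannon_line_continuous.
  exact: (continuous_comp cH (cphi _)).
- by apply: (@is_derive1_comp _ phi H _ _ _ (dphi _ (H0 _ t01)) (dH t t01).1).
- have h1 := @is_derive1_comp _ phi1 H _ _ _ (dphi1 _ (H0 _ t01)) (dH t t01).1.
  apply: (is_derive_eq (is_deriveM h1 (dH t t01).2)).
  by rewrite /GRing.scale/= /H; ring.
- have DE : D t = - \sum_i v i * ln (r t i).
    by rewrite /D; under eq_bigr do rewrite mulrDr mulr1; rewrite big_split/= v0 addr0.
  have prt : prob (r t) by apply: pr; move: t01 => /andP[? ?]; rewrite !ltW.
  have vz i : r t i = 0 -> v i = 0.
    by case: (rpos t i t01) => [/gt_eqF/eqP//|[]].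
  have := entropy_slope_sqr_le prt v0 vz.
  rewrite -[X in X ^+ 2]opprK -DE sqrrN.
  have := hV _ prt (H0 _ t01); have := phi1_ge0 _ (H0 _ t01).
  have S0 : 0 <= \sum_i v i ^+ 2 / r t i.
    by apply: sumr_ge0 => i _; rewrite mulr_ge0 ?sqr_ge0 ?invr_ge0 ?prt.1.
  rewrite /D2; move: S0; set S := \sum_i _; set V := varentropy _.
  set f1 := phi1 _; set f2 := phi2 _ => S0 f10 hf hD.
  (* The upper bound on [D t ^+ 2] can be multiplied by [f2] only if [f2] is nonnegative; otherwise
     both terms are already nonpositive. *)
  have [f20|f20] := leP 0 f2.
    have : f2 * D t ^+ 2 <= f2 * (V * S) by exact: ler_wpM2l.
    have : f2 * V * S <= f1 * S by exact: ler_wpM2r.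
    by rewrite mulrN subr_le0 mulrA => h1 h2; exact: le_trans h1.
  by rewrite mulrN subr_le0 (@le_trans _ _ 0) ?mulr_ge0// mulr_le0_ge0 ?sqr_ge0// ltW.
Qed.

End Shannon.

(** * The varentropy is at most the square of the logarithm of the dimension *)

Section Varentropy.
Context {R : realType}.
Implicit Types x y t L : R.

(** Squaring the cubic bound at half the argument sharpens it enough to reduce the numerical
    estimates below to rational arithmetic. *)
Lemma expR_double_ge (x y c k : R) : y = 2 * x -> 0 <= c ->
  c <= 1 + x + x ^+ 2 / 2 + x ^+ 3 / 6 -> k <= c ^+ 2 -> k <= expR y.
Proof.
move=> -> c0 hc hk; rewrite expRM_natl; apply: le_trans hk _.
apply: lerXn2r; rewrite ?nnegrE ?expR_ge0//.
by apply: le_trans hc _; exact: expR_cubic_le.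
Qed.

Lemma expRN1_ge : 9 / 25 <= expR (- 1 : R).
Proof. by apply: (@expR_double_ge (- (1 / 2)) _ (3 / 5)); lra. Qed.

Lemma expR65_ge : 13 / 4 <= expR (6 / 5 : R).
Proof. by apply: (@expR_double_ge (3 / 5) _ (181 / 100)); lra. Qed.

(** The cubic estimate only bounds [expR] from below; bounding it from above at [x] means bounding
    it from below at [- x]. *)
Lemma le_ln_of_expRN (x y : R) : 0 < y -> y^-1 <= expR (- x) -> x <= ln y.
Proof.
move=> y0; rewrite expRN lef_pV2 ?posrE ?expR_gt0// => h.
by rewrite -ler_expR lnK ?posrE.
Qed.

Lemma ln2_ge : 17 / 25 <= ln (2 : R).
Proof.
apply: le_ln_of_expRN => //.
by apply: (@expR_double_ge (- (17 / 50)) _ (71 / 100)); lra.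
Qed.

Lemma ln3_ge : 107 / 100 <= ln (3 : R).
Proof.
apply: le_ln_of_expRN => //.
by apply: (@expR_double_ge (- (107 / 200)) _ (29 / 50)); lra.
Qed.

(* With [L = ln d] and [x = expR (- L - t)] this becomes [xlnx_shift_sqr_le]. It fails
   for [d = 2], which is why that case is treated separately. *)
Lemma shifted_square_le (L t : R) : 107 / 100 <= L -> - L <= t ->
  (3 / 4 * L + t) ^+ 2 <= L ^+ 2 + 3 / 2 * L * (expR t - 1).
Proof.
move=> hL ht; have [t0|t0] := leP 0 t.
  have he := expR_cubic_le t.
  have : 3 / 2 * L * (t + t ^+ 2 / 2 + t ^+ 3 / 6) <= 3 / 2 * L * (expR t - 1).
    by apply: ler_wpM2l; lra.
  have : 3 / 2 * (t ^+ 2 / 2 + t ^+ 3 / 6) <= L * (3 / 2 * (t ^+ 2 / 2 + t ^+ 3 / 6)).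
    rewrite ler_peMl//; last by lra.
    by have := exprn_ge0 2 t0; have := exprn_ge0 3 t0; lra.
  (* Here [7 / 16 = 1 - (3 / 4) ^+ 2] is what remains of the coefficient of [L ^+ 2], and
     [1 <= L]. *)
  have : t ^+ 2 <= 7 / 16 + 3 / 2 * (t ^+ 2 / 2 + t ^+ 3 / 6).
    have h1 : 0 <= (t - 1) ^+ 2 * (t + 2) by rewrite mulr_ge0 ?sqr_ge0//; lra.
    have h2 := sqr_ge0 (t - 1).
    by nra.
  by nra.
(* The tangent line of [expR] at [-1], with [9 / 25] in place of [expR (- 1)]. *)
have he : 9 / 25 * (2 + t) <= expR t.
  have [s2|s2] := leP (-2) t; last by have := expR_gt0 t; lra.
  have -> : expR t = expR (- (1)) * expR (1 + t) by rewrite -expRD addKr.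
  apply: ler_pM; [lra|lra|exact: expRN1_ge|].
  by apply: le_trans (expR_ge1Dx _); lra.
have : 3 / 2 * L * (9 / 25 * (2 + t) - 1) <= 3 / 2 * L * (expR t - 1).
  by apply: ler_wpM2l; lra.
by nra.
Qed.

(** A second moment is least about the mean: the excess is [(m - shannon p) ^+ 2]. *)
Lemma varentropy_le_shift d (p : 'I_d -> R) (m : R) : prob p ->
  varentropy p <= \sum_i p i * (ln (p i) + m) ^+ 2.
Proof.
move=> [p0 p1].
suff -> : \sum_i p i * (ln (p i) + m) ^+ 2 = varentropy p + (m - shannon p) ^+ 2.
  by rewrite lerDl sqr_ge0.
have e : \sum_i p i * ln (p i) = - shannon p by rewrite opprK.
rewrite /varentropy; move: (shannon p) e => h e.
rewrite (eq_bigr (fun i => p i * (ln (p i) + h) ^+ 2 +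
  (2 * (m - h) * (p i * ln (p i)) + (m ^+ 2 - h ^+ 2) * p i))); last by move=> i _; ring.
by rewrite !big_split/= -!mulr_sumr e p1; ring.
Qed.

(** The right-hand side is affine in [x], and its sum over a probability vector of length [d] is
    exactly [ln d ^+ 2]. It is [shifted_square_le] at [t = - ln x - ln d], multiplied by [x]. *)
Lemma xlnx_shift_sqr_le (d x : R) : 3 <= d -> 0 <= x <= 1 ->
  x * (ln x + ln d / 4) ^+ 2 <= (ln d ^+ 2 - 3 / 2 * ln d) * x + 3 / 2 * ln d / d.
Proof.
move=> d3 /andP[]; have d0 : 0 < d by lra.
have L1 : 107 / 100 <= ln d by apply: le_trans ln3_ge _; rewrite ler_ln ?posrE.
rewrite le_eqVlt => /predU1P[<- _|x0 x1].
  by rewrite mul0r mulr0 add0r mulr_ge0 ?invr_ge0 ?ltW//; lra.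
pose t := - ln x - ln d.
have ht : - ln d <= t by rewrite /t; have := ln_le0 x1; lra.
have := shifted_square_le L1 ht; move/(ler_wpM2l (ltW x0)).
have -> : 3 / 4 * ln d + t = - (ln x + ln d / 4) by rewrite /t; field.
rewrite sqrrN /t expRB expRN !lnK ?posrE// => h; apply: le_trans h _.
by rewrite le_eqVlt; apply/orP; left; apply/eqP; field; rewrite !gt_eqF.
Qed.

(* The proof uses the tangent line of [ln] at [expR (6 / 5)], close to the point where
   the two sides are closest. *)
Lemma ln_le_sym (y : R) : 0 < y -> ln y <= ln 2 / 2 * (y + y^-1).
Proof.
move=> y0.
have e0 := expR_gt0 (- (6 / 5) : R).
have h1 : ln y <= 1 / 5 + expR (- (6 / 5)) * y.
  have : ln (1 + (expR (- (6 / 5)) * y - 1)) <= expR (- (6 / 5)) * y - 1.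
    by apply: le_ln1Dx; have := mulr_gt0 e0 y0; lra.
  by rewrite addrCA subrr addr0 lnM ?posrE// expRK; lra.
have h2 : expR (- (6 / 5) : R) <= 4 / 13.
  rewrite expRN -[leLHS]mul1r ler_pdivrMr ?expR_gt0//.
  by have := expR65_ge; lra.
have h3 : expR (- (6 / 5)) * y <= 4 / 13 * y by rewrite ler_pM2r.
have l2 := ln2_ge.
have h4 : 17 / 50 * (y + y^-1) <= ln 2 / 2 * (y + y^-1).
  by rewrite ler_pM2r ?addr_gt0 ?invr_gt0//; lra.
suff : 1 / 5 + 4 / 13 * y <= 17 / 50 * (y + y^-1) by lra.
rewrite -(ler_pM2r y0) [leRHS](_ : _ = 17 / 50 * (y ^+ 2 + 1)); last by field; rewrite gt_eqF.
(* After multiplication by [y] the difference is a quadratic whose minimum is near [31 / 10]. *)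
have := sqr_ge0 (y - 31 / 10); nra.
Qed.

(** With [r] and [s] the square roots of [x] and [y], the left-hand side is the square of
    [2 * (r * s) * ln (r / s)]. By [ln_le_sym] at [r / s] that base is at most
    [ln 2 * (r ^+ 2 + s ^+ 2)], which is [ln 2]. *)
Lemma binary_varentropy_le (x y : R) : 0 < x -> 0 < y -> x + y = 1 ->
  x * y * (ln x - ln y) ^+ 2 <= ln 2 ^+ 2.
Proof.
wlog xy : x y / ln y <= ln x => [hw x0 y0 e|x0 y0 e].
  have [h|h] := leP (ln y) (ln x); first exact: hw.
  rewrite (mulrC x) -(opprB (ln y)) sqrrN; apply: hw => //; first exact: ltW.
  by rewrite addrC.
set r := Num.sqrt x; set s := Num.sqrt y.
have r0 : 0 < r by rewrite sqrtr_gt0.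
have s0 : 0 < s by rewrite sqrtr_gt0.
have rx : x = r ^+ 2 by rewrite sqr_sqrtr ?ltW.
have sy : y = s ^+ 2 by rewrite sqr_sqrtr ?ltW.
have h := @ln_le_sym (r / s) (divr_gt0 r0 s0).
rewrite ln_div ?posrE// in h.
have l0 : 0 <= ln r - ln s.
  by move: xy; rewrite rx sy !lnXn// !mulr2n; lra.
have h2 : 2 * (r * s) * (ln r - ln s) <= ln 2.
  have : 2 * (r * s) * (ln r - ln s) <= 2 * (r * s) * (ln 2 / 2 * (r / s + (r / s)^-1)).
    by rewrite ler_wpM2l// mulr_ge0 ?mulr_ge0// ltW.
  rewrite [leRHS](_ : _ = ln 2 * (r ^+ 2 + s ^+ 2)); last by field; rewrite !gt_eqF.
  by rewrite -rx -sy e mulr1.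
rewrite rx sy !lnXn// !mulr2n.
rewrite [leLHS](_ : _ = (2 * (r * s) * (ln r - ln s)) ^+ 2); last by ring.
have l20 : 0 <= ln (2 : R) by rewrite ln_ge0//; lra.
by rewrite lerXn2r ?nnegrE// !mulr_ge0// ltW.
Qed.

(** For [d >= 3] the second moment about [ln d / 4] is bounded term by term by an affine function;
    for [d = 2] the varentropy is the binary expression above. *)
Lemma varentropy_le_ln_sqr d (p : 'I_d -> R) : (2 <= d)%N -> prob p ->
  varentropy p <= ln d%:R ^+ 2.
Proof.
rewrite leq_eqVlt => /predU1P[e|d3] pp.
  case: _ / e p pp => p pp.
  have := pp.2; rewrite !big_ord_recl big_ord0 addr0.
  set x := p _; set y := p _ => exy.
  have x0 : 0 <= x := pp.1 _. have y0 : 0 <= y := pp.1 _.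
  have -> : varentropy p = x * y * (ln x - ln y) ^+ 2.
    rewrite /varentropy /shannon !big_ord_recl !big_ord0 !addr0 -/x -/y.
    have -> : x = 1 - y by lra.
    by ring.
  have [ex|x1] := eqVneq x 0; first by rewrite ex !mul0r sqr_ge0.
  have [ey|y1] := eqVneq y 0; first by rewrite ey mulr0 !mul0r sqr_ge0.
  by apply: binary_varentropy_le; rewrite ?lt_def ?x1 ?y1.
have d3R : 3 <= d%:R :> R by rewrite ler_nat.
apply: (le_trans (varentropy_le_shift (ln d%:R / 4) pp)).
apply: (@le_trans _ _ (\sum_i ((ln d%:R ^+ 2 - 3 / 2 * ln d%:R) * p i + 3 / 2 * ln d%:R / d%:R))).
  by apply: ler_sum => i _; apply: xlnx_shift_sqr_le => //; rewrite pp.1 prob_le1.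
rewrite big_split/= -mulr_sumr pp.2 sumr_const card_ord -mulr_natl mulr1.
rewrite le_eqVlt; apply/orP; left; apply/eqP; field; rewrite gt_eqF//; lra.
Qed.

End Varentropy.

(** * Photon number and geometric distributions *)

Section PhotonNumber.
Context {R : realType}.
Implicit Types x y M N : R.

(* [logr N] is the derivative of [gfun]; [geomvar N] is the varentropy of the
   geometric distribution of mean [N], whose entropy is [gfun N]; and [slope N]
   is the derivative of the former with respect to the latter. *)
Definition logr x := ln (x + 1) - ln x.
Definition geomvar x := x * (x + 1) * logr x ^+ 2.
Definition slope x := (2 * x + 1) * logr x - 2.

Lemma shift_derive x : is_derive x 1 (fun y : R => y + 1) 1.
Proof.
have h := is_deriveD (is_derive_id x (1 : R)) (is_derive_cst (1 : R) x 1).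
by apply: (is_derive_eq h); rewrite addr0.
Qed.

Lemma addr1_gt0 x : 0 < x -> 0 < x + 1. Proof. by move=> ?; lra. Qed.

Lemma gfun_derive x : 0 < x -> is_derive x 1 (@gfun R) (logr x).
Proof.
move=> x0.
have d1 := @is_derive1_comp _ (fun y => y * ln y) (fun y => y + 1) _ _ _
  (xlnx_derive (addr1_gt0 x0)) (shift_derive x).
apply: (is_derive_eq (is_deriveB d1 (xlnx_derive x0))).
by rewrite /logr; ring.
Qed.

Lemma logr_derive x : 0 < x -> is_derive x 1 logr (- (x * (x + 1))^-1).
Proof.
move=> x0.
have d1 := @is_derive1_comp _ (@ln R) (fun y => y + 1) _ _ _
  (is_derive1_ln (addr1_gt0 x0)) (shift_derive x).
apply: (is_derive_eq (is_deriveB d1 (is_derive1_ln x0))).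
by field; rewrite !gt_eqF ?addr1_gt0.
Qed.

Lemma logr_gt0 x : 0 < x -> 0 < logr x.
Proof. by move=> x0; rewrite subr_gt0 ltr_ln ?posrE ?addr1_gt0//; lra. Qed.

Lemma geomvar_derive x : 0 < x -> is_derive x 1 geomvar (logr x * slope x).
Proof.
move=> x0; have dl := logr_derive x0.
have h := is_deriveM (is_deriveM (is_derive_id x (1 : R)) (shift_derive x)) (is_deriveM dl dl).
apply: (is_derive_eq h).
rewrite /GRing.scale/= !mulrfctE/= /slope; field.
by rewrite !gt_eqF ?addr1_gt0.
Qed.

Lemma slope_derive x : 0 < x ->
  is_derive x 1 slope (2 * logr x - x^-1 - (x + 1)^-1).
Proof.
move=> x0; have dl := logr_derive x0.
have h := is_deriveB (is_deriveM (is_deriveD (is_deriveM (is_derive_cst (2 : R) x 1)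
  (is_derive_id x (1 : R))) (is_derive_cst (1 : R) x 1)) dl) (is_derive_cst (2 : R) x 1).
apply: (is_derive_eq h).
rewrite /GRing.scale/= !(mulrfctE, addrfctE)/=; field.
by rewrite !gt_eqF ?addr1_gt0.
Qed.

(** The trapezoidal rule overestimates the integral of the convex function [z^-1] over [[1, y]]. At
    [y = (x + 1) / x] this says that [slope] has nonpositive derivative. *)
Lemma ln_trapezoid y : 1 <= y -> 2 * ln y <= y - y^-1.
Proof.
move=> y1; pose k z : R := z - z^-1 - 2 * ln z.
have dk z : 1 <= z <= y -> is_derive z 1 k ((1 - z^-1) ^+ 2).
  move=> /andP[z1 _]; have z0 : 0 < z by lra.
  have h := is_deriveB (is_deriveB (is_derive_id z (1 : R)) (@is_deriveV _ id z _ _ (lt0r_neq0 z0) (is_derive_id z (1 : R))))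
    (is_deriveM (is_derive_cst (2 : R) z 1) (is_derive1_ln z0)).
  apply: (is_derive_eq h).
  by rewrite /GRing.scale/=; field; rewrite !gt_eqF.
have := derive_ge0_le y1 dk (fun z _ => sqr_ge0 _).
by rewrite /k ln1 invr1; lra.
Qed.

(** The midpoint rule underestimates the same integral. At [y = (x + 1) / x] this is the
    nonnegativity of [slope]. *)
Lemma ln_midpoint y : 1 <= y -> 2 * (y - 1) <= (y + 1) * ln y.
Proof.
move=> y1; pose k z : R := (z + 1) * ln z - 2 * (z - 1).
have dk z : 1 <= z <= y -> is_derive z 1 k (ln z - (1 - z^-1)).
  move=> /andP[z1 _]; have z0 : 0 < z by lra.
  have h := is_deriveB (is_deriveM (shift_derive z) (is_derive1_ln z0))
    (is_deriveM (is_derive_cst (2 : R) z 1) (is_deriveB (is_derive_id z (1 : R)) (is_derive_cst (1 : R) z 1))).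
  apply: (is_derive_eq h).
  by rewrite /GRing.scale/=; field; rewrite !gt_eqF.
have := derive_ge0_le y1 dk; rewrite /k ln1 => h.
suff : (1 + 1) * 0 - 2 * (1 - 1) <= (y + 1) * ln y - 2 * (y - 1) by lra.
apply: h => z /andP[z1 _]; have z0 : 0 < z by lra.
have : ln (1 + (z^-1 - 1)) <= z^-1 - 1.
  by apply: le_ln1Dx; have := z0; rewrite -invr_gt0; lra.
by rewrite addrCA subrr addr0 lnV ?posrE//; lra.
Qed.

Lemma logrE x : 0 < x -> logr x = ln ((x + 1) / x).
Proof. by move=> x0; rewrite ln_div ?posrE ?addr1_gt0. Qed.

Lemma slope_ge0 x : 0 < x -> 0 <= slope x.
Proof.
move=> x0; have y1 : 1 <= (x + 1) / x by rewrite ler_pdivlMr//; lra.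
have := ln_midpoint y1; rewrite -logrE// => /(ler_wpM2l (ltW x0)).
rewrite [leLHS](_ : _ = 2); last by field; rewrite gt_eqF.
rewrite [leRHS](_ : _ = (2 * x + 1) * logr x); last by field; rewrite gt_eqF.
by rewrite /slope; lra.
Qed.

Lemma slope_nincr x y : 0 < x -> x <= y -> slope y <= slope x.
Proof.
move=> x0 xy; rewrite -lerN2.
pose f z : R := - slope z; pose f1 z : R := - (2 * logr z - z^-1 - (z + 1)^-1).
apply: (@derive_ge0_le R f f1 x y xy) => z /andP[xz _]; have z0 := lt_le_trans x0 xz.
  by have h := is_deriveN (slope_derive z0).
have z1 : 1 <= (z + 1) / z by rewrite ler_pdivlMr//; lra.
have := ln_trapezoid z1; rewrite -logrE// /f1.
rewrite [leRHS](_ : _ = z^-1 + (z + 1)^-1); last by field; rewrite !gt_eqF ?addr1_gt0.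
by lra.
Qed.

Lemma gfun0 : gfun 0 = 0 :> R.
Proof. by rewrite /gfun add0r ln1 mulr0 mul0r subrr. Qed.

(* The geometric varentropy is a concave function of the geometric entropy. *)
Lemma geomvar_tangent M N : 0 < M -> 0 < N ->
  geomvar M <= geomvar N + slope N * (gfun M - gfun N).
Proof.
move=> M0 N0.
(* The derivative of [F] is [logr x * (slope N - slope x)]; as [slope] is nonincreasing, [F] is
   least at [N]. *)
pose F x := slope N * gfun x - geomvar x.
have dF x : 0 < x -> is_derive x 1 F (logr x * (slope N - slope x)).
  move=> x0; have h := is_deriveB (is_deriveM (is_derive_cst (slope N) x 1) (gfun_derive x0)) (geomvar_derive x0).
  by apply: (is_derive_eq h); rewrite /GRing.scale/=; ring.
suff : F N <= F M by rewrite /F; lra.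
have [NM|/ltW MN] := leP N M.
  apply: (derive_ge0_le NM (fun x h => dF x (lt_le_trans N0 (andP h).1))) => x /andP[Nx _].
  by apply: mulr_ge0; [exact/ltW/logr_gt0/(lt_le_trans N0) | rewrite subr_ge0 slope_nincr].
rewrite -lerN2.
have dNF x : 0 < x -> is_derive x 1 (fun z => - F z) (- (logr x * (slope N - slope x))).
  by move=> x0; exact: is_deriveN (dF x x0).
apply: (derive_ge0_le MN (fun x h => dNF x (lt_le_trans M0 (andP h).1))) => x /andP[Mx xN].
have x0 := lt_le_trans M0 Mx.
by rewrite -mulrN opprB; apply: mulr_ge0; [exact/ltW/logr_gt0 | rewrite subr_ge0 slope_nincr].
Qed.

Lemma gfun_continuous : continuous (@gfun R).
Proof.
move=> x.
have c1 : {for x, continuous (fun y : R => y + 1)}.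
  by apply: differentiable_continuous; apply/derivable1_diffP; case: (shift_derive x).
exact: (continuousB (continuous_comp c1 (@xlnx_continuous R _)) (@xlnx_continuous R x)).
Qed.

Lemma gfun_gt0 x : 0 < x -> 0 < gfun x.
Proof.
move=> x0.
have -> : gfun x = ln (x + 1) + x * logr x by rewrite /gfun /logr; ring.
by rewrite addr_gt0 ?mulr_gt0 ?logr_gt0 ?ln_gt0//; lra.
Qed.

Lemma gfun_lt x y : 0 <= x -> x < y -> gfun x < gfun y.
Proof.
rewrite le_eqVlt => /predU1P[<- y0|x0 xy]; first by rewrite gfun0 gfun_gt0.
have dg z : z \in `]x, y[ -> is_derive z 1 (@gfun R) (logr z).
  by rewrite in_itv/= => /andP[xz _]; apply: gfun_derive; exact: lt_trans xz.
have [c] := MVT xy dg (continuous_subspaceT gfun_continuous).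
rewrite in_itv/= => /andP[xc _] e; rewrite -subr_gt0 e; apply: mulr_gt0; last by rewrite subr_gt0.
by apply: logr_gt0; exact: lt_trans xc.
Qed.

Lemma gfun_inj : {in `[0, +oo[%classic &, injective (@gfun R)}.
Proof.
move=> x y; rewrite !inE/= !in_itv/= !andbT => x0 y0 e.
have [/(gfun_lt x0)|/(gfun_lt y0)|//] := ltgtP x y; by rewrite e ltxx.
Qed.

Lemma gfun_surj y : 0 <= y -> exists2 x, 0 <= x & gfun x = y.
Proof.
move=> y0.
(* The right end [x = expR y - 1] for the intermediate value theorem has [ln (x + 1) = y], and
   [gfun x = ln (x + 1) + x * logr x]. *)
have b0 : 0 <= expR y - 1 by rewrite subr_ge0 -expR0 ler_expR.
have gb : y <= gfun (expR y - 1).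
  move: b0; rewrite le_eqVlt => /predU1P[/esym e|b0].
    suff -> : y = 0 by rewrite expR0 subrr gfun0.
    by move/subr0_eq: e; rewrite -expR0; exact: expR_inj.
  have -> : gfun (expR y - 1) = y + (expR y - 1) * logr (expR y - 1).
    by rewrite /gfun /logr subrK expRK; ring.
  by rewrite lerDl mulr_ge0// ltW// logr_gt0.
have [|x] := @IVT R (@gfun R) 0 (expR y - 1) y b0 (continuous_subspaceT gfun_continuous).
  by rewrite gfun0 (min_idPl _) ?(max_idPr _) ?y0// (le_trans y0).
by rewrite in_itv/= => /andP[x0 _] e; exists x.
Qed.

Lemma gfunK x : 0 <= x -> ginv (gfun x) = x.
Proof.
move=> x0; have xi : x \in `[0, +oo[%classic by rewrite inE/= in_itv/= x0.
by have := pinvKV (fun=> 0) gfun_inj xi.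
Qed.

Lemma ginvK y : 0 <= y -> gfun (ginv y) = y.
Proof. by move=> /gfun_surj[x x0 <-]; rewrite gfunK. Qed.

Lemma ginv_ge0 y : 0 <= y -> 0 <= ginv y.
Proof. by move=> /gfun_surj[x x0 <-]; rewrite gfunK. Qed.

Lemma ginv_gt0 y : 0 < y -> 0 < ginv y.
Proof.
move=> y0; rewrite lt_def ginv_ge0 ?(ltW y0)// andbT.
by apply/eqP => e; have := ginvK (ltW y0); rewrite e gfun0 => /esym/eqP; rewrite gt_eqF.
Qed.

Lemma ginv0 : ginv 0 = 0 :> R.
Proof. by rewrite -{1}gfun0 gfunK. Qed.

Lemma ginv_lt x y : 0 <= x -> 0 <= y -> x < gfun y -> ginv x < y.
Proof.
move=> x0 y0 h; have [//|h1] := ltP (ginv x) y.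
suff : gfun y <= x by rewrite leNgt h.
rewrite -(ginvK x0); move: h1; rewrite le_eqVlt => /predU1P[->//|h1].
exact/ltW/gfun_lt.
Qed.

Lemma ginv_derive y : 0 < y -> is_derive y 1 (@ginv R) (logr (ginv y))^-1.
Proof.
move=> y0; rewrite -{1}(ginvK (ltW y0)).
have x0 := ginv_gt0 y0.
apply: (@is_derive_inverse _ (@gfun R)).
- near=> z; apply: gfunK; apply: ltW; near: z; exact: lt_nbhsr.
- by near=> z; exact: gfun_continuous.
- exact: gfun_derive.
- by rewrite gt_eqF ?logr_gt0.
Unshelve. all: by end_near. Qed.

(* Composing with the norm makes [ginv] continuous on the whole line, whatever
   its junk values at negative numbers. *)
Lemma ginv_norm_continuous : continuous (fun y : R => ginv `|y|).
Proof.
move=> y; have [->|y0] := eqVneq y 0.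
  rewrite /continuous_at normr0 ginv0; apply/cvgr0Pnorm_lt => /= e e0.
  have hz : \forall z \near (0 : R), `|z| < gfun e by exact: nbhs0_lt (gfun_gt0 e0).
  near=> z; rewrite ger0_norm ?ginv_ge0//; apply: ginv_lt => //; first exact: ltW.
  by near: z.
have c1 : {for `|y|, continuous (@ginv R)}.
  apply: differentiable_continuous; apply/derivable1_diffP.
  by case: (@ginv_derive `|y|); rewrite ?normr_gt0.
exact: (continuous_comp (@norm_continuous _ R y) c1).
Unshelve. all: by end_near. Qed.

Lemma geomvar_ge0 x : 0 <= x -> 0 <= geomvar x.
Proof.
by move=> x0; apply: mulr_ge0; [apply: mulr_ge0 => //; lra | exact: sqr_ge0].
Qed.

Lemma geomvar0 : geomvar 0 = 0.
Proof. by rewrite /geomvar !mul0r. Qed.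

(** The tangent inequality at [M = 0]. Were it to fail, a point [x > 0] with [gfun x = e] would have
    [geomvar x <= - e], against its nonnegativity. *)
Lemma geomvar_tangent0 N : 0 < N -> slope N * gfun N <= geomvar N.
Proof.
move=> N0; rewrite leNgt; apply/negP => h.
pose e := (slope N * gfun N - geomvar N) / (slope N + 1).
have s0 := slope_ge0 N0.
have e0 : 0 < e by rewrite divr_gt0 ?subr_gt0//; lra.
have [x x0 gx] := gfun_surj (ltW e0).
have {}x0 : 0 < x.
  rewrite lt_def x0 andbT; apply/eqP => ex.
  by move: gx e0; rewrite ex gfun0 => <-; rewrite ltxx.
have := geomvar_tangent x0 N0; have := geomvar_ge0 (ltW x0); rewrite gx.
have : e * (slope N + 1) = slope N * gfun N - geomvar N.
  by rewrite /e divfK// gt_eqF//; lra.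
nra.
Qed.

Lemma geomvar_tangent_ge0 M N : 0 <= M -> 0 < N ->
  geomvar M <= geomvar N + slope N * (gfun M - gfun N).
Proof.
rewrite le_eqVlt => /predU1P[<- N0|]; last exact: geomvar_tangent.
by rewrite geomvar0 gfun0; have := geomvar_tangent0 N0; lra.
Qed.

(* Here [q] is the largest probability. The mean [N = p * k ^+ 2], with
   [k = ln (p / q) / ln p], is small enough for the upper bound on the entropy and,
   since [N * ln p ^+ 2 = p * ln (p / q) ^+ 2], large enough for the varentropy. *)
Lemma geometric_term p q : 0 <= p -> p <= q -> p + q <= 1 -> 0 < q < 1 ->
  exists N, [/\ 0 <= N, p * (ln p - ln q) ^+ 2 <= geomvar N &
    gfun N <= p * (- ln p - q / (1 - q) * ln q)].
Proof.
rewrite le_eqVlt => /predU1P[<- _ _ _|p0 pq pq1 /andP[q0 q1]].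
  by exists 0; rewrite geomvar0 gfun0 !mul0r.
pose b := - ln q; pose l := - ln p; pose k := (l - b) / l.
have b0 : 0 < b by rewrite oppr_gt0 ln_lt0// q0.
have bl : b <= l by rewrite lerN2 ler_ln ?posrE.
have l0 : 0 < l := lt_le_trans b0 bl.
have kl : k * l = l - b by rewrite divfK// gt_eqF.
have k0 : 0 <= k by rewrite divr_ge0 ?subr_ge0// ltW.
have k1 : k <= 1 by rewrite ler_pdivrMr// mul1r gerBl ltW.
(* This and [qs] add up to [1 <= b + q / (1 - q) * b], which closes the entropy estimate at the
   end. *)
have xb : 1 - q <= b.
  have : ln (1 + (q - 1)) <= q - 1 by apply: le_ln1Dx; lra.
  by rewrite addrCA subrr addr0 /b; lra.
have qs : q <= q / (1 - q) * b.
  by rewrite mulrAC ler_pdivlMr ?subr_gt0// ler_wpM2l// ltW.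
rewrite -mulrN -/b -/l.
rewrite (_ : (ln p - ln q) ^+ 2 = (l - b) ^+ 2); last by rewrite /l /b; ring.
exists (p * k ^+ 2).
(* [k = 0] means [p = q]; then [N = 0] and both left-hand sides vanish. *)
have [ek|kn0] := eqVneq k 0.
  rewrite ek expr0n mulr0 geomvar0 gfun0 -kl ek mul0r expr0n mulr0; split=> //.
  apply: mulr_ge0; [exact: ltW | lra].
have {kn0}k0 : 0 < k by rewrite lt_def kn0.
set N := p * k ^+ 2.
have N0 : 0 < N by rewrite mulr_gt0// exprn_gt0.
have kn n : k ^+ n <= 1 by apply: exprn_ile1 => //; exact: ltW.
have Np : N <= p by apply: ler_piMr => //; exact: ltW.
have lnN : ln N = - l + 2 * ln k.
  by rewrite lnM ?posrE ?exprn_gt0// lnXn// /l opprK mulr2n; ring.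
have lN1 : 0 <= ln (N + 1) by rewrite ln_ge0//; lra.
have lk : - ln k <= k^-1 - 1.
  have : ln (1 + (k^-1 - 1)) <= k^-1 - 1.
    by apply: le_ln1Dx; have := k0; rewrite -invr_gt0; lra.
  by rewrite addrCA subrr addr0 lnV ?posrE.
split; first exact: ltW.
  have lnk : ln k <= 0 by rewrite ln_le0.
  (* As [k <= 1], [- ln N = l - 2 * ln k] is at least [l]. *)
  have hl : l ^+ 2 <= logr N ^+ 2.
    by apply: lerXn2r; rewrite ?nnegrE; [exact: ltW | exact/ltW/logr_gt0 | rewrite /logr lnN; lra].
  rewrite -kl (_ : p * (k * l) ^+ 2 = N * l ^+ 2); last by rewrite /N; ring.
  apply: ler_pM => //; [exact: ltW | exact: sqr_ge0 |].
  by apply: ler_peMr; [exact: ltW | lra].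
have h1 : ln (N + 1) <= N by rewrite addrC le_ln1Dx//; lra.
have h2 : (N + 1) * ln (N + 1) <= (N + 1) * N by rewrite ler_wpM2l//; lra.
have h3 : N * (- ln k) <= N * (k^-1 - 1) by rewrite ler_wpM2l// ltW.
have h4 : N * k^-1 = p * k by rewrite /N; field; rewrite gt_eqF.
(* Obtained from [ln (N + 1) <= N] and [- ln k <= k^-1 - 1], using [N / k = p * k] and
   [k * l = l - b]. *)
apply: (@le_trans _ _ (p * (k * (l - b) - k ^+ 2 + p * k ^+ 4 + 2 * k))).
  rewrite /gfun lnN -kl.
  have -> : p * (k * (k * l) - k ^+ 2 + p * k ^+ 4 + 2 * k) =
    N * l - N + N * N + 2 * (p * k) by rewrite /N; ring.
  by nra.
rewrite ler_pM2l//.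
have h5 : p * k ^+ 4 <= b * k.
  have -> : p * k ^+ 4 = (p * k ^+ 3) * k by ring.
  apply: ler_wpM2r; first exact: ltW.
  apply: (@le_trans _ _ p).
    by apply: ler_piMr => //; exact: ltW.
  lra.
(* With [h5], what is left is [l - b + 2 * k - k ^+ 2], at most [l - b + 1]. *)
have := sqr_ge0 (k - 1).
have -> : k * (l - b) = l - b - k * b by rewrite mulrBr kl.
by nra.
Qed.

(** The second moment about [- ln] of the largest probability loses that term; [geometric_term]
    bounds each of the [d - 1] others by some [geomvar (M i)]. The entropies [gfun (M i)] sum to at
    most [shannon p]: the share of the largest probability is split among the others in proportion
    to [p i]. Sum the tangent inequalities at [N], multiply by [c], and use [c * (d - 1) <= 1] and
    [c * shannon p = gfun N]. *)
Lemma varentropy_le_geomvar d (p : 'I_d -> R) (c N : R) : (2 <= d)%N -> prob p ->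
  0 <= c <= 1 / (d%:R - 1) -> 0 < N -> gfun N = c * shannon p ->
  c * varentropy p <= geomvar N.
Proof.
move=> d2 pp /andP[c0 c1] N0 gN.
have d1 : 0 < d%:R - 1 :> R by rewrite subr_gt0 ltr1n.
have cd : c * (d%:R - 1) <= 1 by rewrite -ler_pdivlMr.
have i0 : 'I_d by exact: (Ordinal (ltnW d2)).
have [i1 hmax] : exists i1, forall i, p i <= p i1.
  have [i1 _ h] := @arg_maxP _ R 'I_d i0 xpredT p isT.
  by exists i1 => i; exact: h.
have hsum i : i != i1 -> p i + p i1 <= 1.
  move=> ii; rewrite -pp.2 (bigD1 i1)//= (bigD1 i)//= [leLHS]addrC lerD2l lerDl.
  by apply: sumr_ge0 => j _; exact: pp.1.
have V1 : varentropy p <= \sum_(i | i != i1) p i * (ln (p i) - ln (p i1)) ^+ 2.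
  apply: (le_trans (varentropy_le_shift (- ln (p i1)) pp)).
  by rewrite (bigD1 i1)//= subrr expr0n mulr0 add0r.
have [e1|ne1] := eqVneq (p i1) 1.
  apply: (@le_trans _ _ 0); last exact/geomvar_ge0/ltW.
  rewrite mulr_ge0_le0//; apply: le_trans V1 _.
  apply: sumr_le0 => i /hsum; rewrite e1 -lerBrDr subrr => h.
  by rewrite (_ : p i = 0) ?mul0r//; apply/le_anti; rewrite h pp.1.
have q1 : p i1 < 1 by rewrite lt_neqAle ne1 prob_le1.
have q0 : 0 < p i1.
  rewrite lt_def pp.1 andbT; apply/eqP => e.
  have := pp.2; rewrite big1 => [/eqP|i _]; first by rewrite eq_sym oner_eq0.
  by apply/le_anti; rewrite pp.1 -e hmax.
have /choice[M hM] i : exists M, i != i1 -> [/\ 0 <= M,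
    p i * (ln (p i) - ln (p i1)) ^+ 2 <= geomvar M &
    gfun M <= p i * (- ln (p i) - p i1 / (1 - p i1) * ln (p i1))].
  have [|ii] := eqVneq i i1; first by exists 0.
  have [|M hM] := @geometric_term (p i) (p i1) (pp.1 i) (hmax i) (hsum i ii); first by rewrite q0.
  by exists M.
have card1 : \sum_(i | i != i1) 1 = d%:R - 1 :> R.
  have : \sum_(i < d) 1 = d%:R :> R by rewrite sumr_const card_ord.
  by rewrite (bigD1 i1)//= => <-; ring.
have hH : \sum_(i | i != i1) gfun (M i) <= shannon p.
  apply: (@le_trans _ _ (\sum_(i | i != i1) (- (p i * ln (p i)) + (- (p i1 / (1 - p i1) * ln (p i1))) * p i))).
    by apply: ler_sum => i /hM[_ _]; rewrite mulrBr mulrN [X in _ - X]mulrC mulNr.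
  have hs : \sum_(i | i != i1) p i = 1 - p i1.
    by have := pp.2; rewrite (bigD1 i1)//= => <-; ring.
  rewrite big_split/= -mulr_sumr hs sumrN /shannon [in leRHS](bigD1 i1)//=.
  rewrite opprD addrC lerD2r le_eqVlt; apply/orP; left; apply/eqP; field.
  by rewrite subr_eq0 eq_sym.
have hV : varentropy p <= (d%:R - 1) * (geomvar N - slope N * gfun N) + slope N * shannon p.
  apply: (le_trans V1); apply: (@le_trans _ _ (\sum_(i | i != i1)
     ((geomvar N - slope N * gfun N) * 1 + slope N * gfun (M i)))).
    apply: ler_sum => i /hM[M0 h _]; apply: le_trans h _.
    by have := geomvar_tangent_ge0 M0 N0; lra.
  rewrite big_split/= -!mulr_sumr card1 mulrC lerD2l.
  by apply: ler_wpM2l => //; exact: slope_ge0.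
have := ler_wpM2l c0 hV; have := geomvar_tangent0 N0.
have -> : c * ((d%:R - 1) * (geomvar N - slope N * gfun N) + slope N * shannon p) =
  c * (d%:R - 1) * (geomvar N - slope N * gfun N) + slope N * (c * shannon p) by ring.
rewrite -gN.
have : c * (d%:R - 1) * (geomvar N - slope N * gfun N) <= 1 * (geomvar N - slope N * gfun N).
  by apply: ler_wpM2r => //; rewrite subr_ge0; exact: geomvar_tangent0.
lra.
Qed.

(** For [phi x = ginv (c * x)] and [N = phi (shannon r)], the condition [phi2 * V <= phi1] is
    [c * V <= geomvar N]. The value [c = 0] is set apart because [ginv] is differentiated only at
    positive points. *)
Lemma photon_number_concave d (p q : 'I_d -> R) (a c : R) : (2 <= d)%N ->
  prob p -> prob q -> 0 <= a <= 1 -> 0 <= c <= 1 / (d%:R - 1) ->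
  a * ginv (c * shannon p) + (1 - a) * ginv (c * shannon q) <=
  ginv (c * shannon (fun i => a * p i + (1 - a) * q i)).
Proof.
move=> d2 pp pq a01 /[dup] hc /andP[]; rewrite le_eqVlt => /predU1P[<- _|c0 c1].
  by rewrite !mul0r ginv0 !mulr0 addr0.
pose phi x : R := ginv `|c * x|.
pose phi1 x : R := c * (logr (ginv (c * x)))^-1.
pose phi2 x : R := c * (- (logr (ginv (c * x))) ^- 2 * (- (ginv (c * x) * (ginv (c * x) + 1))^-1 * ((logr (ginv (c * x)))^-1 * c))).
have cx x : 0 < x -> 0 < c * x by exact: mulr_gt0.
have phiE r : prob r -> phi (shannon r) = ginv (c * shannon r).
  by move=> pr; rewrite /phi ger0_norm// mulr_ge0 ?shannon_ge0// ltW.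
have dg x : 0 < x -> is_derive x 1 (fun y => ginv (c * y)) ((logr (ginv (c * x)))^-1 * c).
  by move=> x0; apply: (@is_derive1_comp _ (@ginv R) (fun y => c * y) _ _ _ (ginv_derive (cx _ x0)) (mull_derive c x)).
have := @shannon_comp_concave R d phi phi1 phi2 p q a.
rewrite !phiE//; last exact: prob_conv.
apply=> // [x|x x0|x x0|x x0|r pr r0].
- have c1' : {for x, continuous (fun y : R => c * y)}.
    by apply: differentiable_continuous; apply/derivable1_diffP; case: (mull_derive c x).
  exact: (continuous_comp c1' (@ginv_norm_continuous _)).
- rewrite /phi1 mulrC; apply: near_eq_is_derive (dg x x0).
  near=> y; rewrite /phi gtr0_norm//; apply: cx; near: y; exact: lt_nbhsr.
- have N0 := ginv_gt0 (cx _ x0).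
  have h1 := @is_derive1_comp _ logr (fun y => ginv (c * y)) _ _ _ (logr_derive N0) (dg x x0).
  have ln0 : (logr \o (fun y => ginv (c * y))) x != 0 by rewrite /= gt_eqF ?logr_gt0.
  have h := is_deriveM (is_derive_cst c x (1 : R)) (is_deriveV ln0 h1).
  apply: (is_derive_eq h).
  by rewrite /GRing.scale/= mulr0 addr0.
- by rewrite mulr_ge0 ?(ltW c0)// invr_ge0 ltW// logr_gt0// ginv_gt0// cx.
- rewrite /phi1 /phi2; set N := ginv _.
  have N0 : 0 < N := ginv_gt0 (cx _ r0).
  have l0 := logr_gt0 N0.
  have gN : gfun N = c * shannon r by rewrite ginvK// ltW// cx.
  have hV := varentropy_le_geomvar d2 pr hc N0 gN.
  rewrite [leLHS](_ : _ = c * (logr N)^-1 * (c * varentropy r / geomvar N)); last first.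
    by rewrite /geomvar; field; rewrite !gt_eqF ?addr1_gt0.
  rewrite ler_piMr ?mulr_ge0 ?invr_ge0 ?(ltW c0) ?(ltW l0)//.
  rewrite ler_pdivrMr ?mul1r// /geomvar !mulr_gt0 ?exprn_gt0//; lra.
Unshelve. all: by end_near. Qed.

End PhotonNumber.

(** * Spectra and projectors *)

Lemma sum_indicator_lt {R : pzSemiRingType} {d : nat} (k : nat) : (k <= d)%N ->
  \sum_(i < d) (i < k)%N%:R = k%:R :> R.
Proof.
move=> kd; have := big_ord_widen (op := +%R) (idx := 0) d (fun=> 1 : R) kd.
rewrite sumr_const card_ord => ->; rewrite [RHS]big_mkcond.
by apply: eq_bigr => i _; case: ltnP.
Qed.

(** Both weightings have total [k], so a threshold [t] may be subtracted from [l]. With [t] the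
    value at position [k], each [l i - t] has the sign of the weight difference beside it. *)
Lemma sum_le_top {R : numDomainType} {d : nat} (l y : 'I_d -> R) (k : nat) :
  (forall i j : 'I_d, (i <= j)%N -> l j <= l i) -> (k <= d)%N ->
  (forall i, 0 <= y i <= 1) -> \sum_i y i = k%:R ->
  \sum_i l i * y i <= \sum_(i < d | (i < k)%N) l i.
Proof.
case: d l y => [|d] l y hl kd hy sy.
  by rewrite !big_ord0.
(* The length is now [d.+1]; the minimum keeps the index in range when [k = d.+1]. *)
pose t := l (inord (minn k d)).
have card := @sum_indicator_lt R _ _ kd.
rewrite -subr_ge0 big_mkcond -sumrB.
suff -> : \sum_(i < d.+1) ((if (i < k)%N then l i else 0) - l i * y i) =
    \sum_(i < d.+1) (l i - t) * ((i < k)%N%:R - y i).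
  apply: sumr_ge0 => i _; have /andP[y0 y1] := hy i.
  case: ltnP => ik; last first.
    rewrite -[X in 0 <= X]mulrNN mulr_ge0// ?opprB ?subr0// ?subr_ge0 ?sub0r ?opprK//.
    by apply: hl; rewrite inordK ?ltnS ?geq_minr// (leq_trans (geq_minl _ _)).
  rewrite mulr_ge0 ?subr_ge0//; apply: hl; rewrite inordK ?ltnS ?geq_minr//.
  by rewrite leq_min (ltnW ik) -ltnS ltn_ord.
rewrite [RHS](eq_bigr (fun i : 'I_d.+1 => l i * ((i < k)%N%:R - y i) - t * ((i < k)%N%:R - y i)));
  last by move=> i _; rewrite mulrBl.
rewrite [RHS]sumrB -[X in _ - X]mulr_sumr [X in _ - _ * X]sumrB card sy subrr mulr0 subr0.
by apply: eq_bigr => i _; case: ltnP => _; rewrite ?mulrBr ?mulr1 ?mulr0.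
Qed.

Section Spectral.
Local Open Scope sesquilinear_scope.
Context {R : realType} {d : nat}.
Local Notation C := (R[i]).
Implicit Types A B P : 'M[C]_d.

Lemma spectral_decomp A : A \is hermsymmx ->
  exists U : 'M[C]_d, exists lam : 'I_d -> R,
    [/\ U \is unitarymx, A = U^t* *m diag_mx (\row_i (lam i)%:C%C) *m U &
        entropy A = shannon lam].
Proof.
move=> hA; exists (spectralmx A), (fun i => complex.Re (spectral_diag A ord0 i)).
split=> //; first exact: spectral_unitarymx.
have /hermitian_normalmx/orthomx_spectralP := hA.
rewrite invmx_unitary ?spectral_unitarymx//.
suff <- : spectral_diag A = \row_i (complex.Re (spectral_diag A ord0 i))%:C%C by [].
apply/rowP => i; rewrite !mxE.
have /mxOverP/(_ ord0 i) := hermitian_spectral_diag_real hA.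
by move=> /RRe_real.
Qed.

End Spectral.

Section Projector.
Local Open Scope sesquilinear_scope.
Context {C : numClosedFieldType} {d : nat}.
Implicit Types A B P Q U : 'M[C]_d.

Definition projector P := P^t* = P /\ P *m P = P.

Lemma trmxC_mul m n p (A : 'M[C]_(m, n)) (B : 'M[C]_(n, p)) :
  (A *m B)^t* = B^t* *m A^t*.
Proof. by rewrite trmx_mul map_mxM. Qed.

Lemma projector_conj P U : U \is unitarymx -> projector P ->
  projector (U *m P *m U^t*) /\ \tr (U *m P *m U^t*) = \tr P.
Proof.
move=> /unitarymxP hU [hP PP]; have hU' := mulmx1C hU; split; last by rewrite mxtrace_mulC mulmxA hU' mul1mx.
split; first by rewrite !trmxC_mul trmxCK hP mulmxA.
by rewrite !mulmxA -(mulmxA (U *m P)) hU' mulmx1 -(mulmxA U P P) PP.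
Qed.

Lemma projector_entry P i j : projector P -> P j i = (P i j)^*.
Proof. by move=> [hP _]; rewrite -[in LHS]hP !mxE. Qed.

Lemma projector_row P i : projector P -> \sum_j P i j * P j i = P i i.
Proof. by move=> [_ PP]; rewrite -[in RHS]PP mxE. Qed.

(* The left-hand side is
   [\sum_i l i * x i] with weights
   [x i = P i i + \sum_j (l i - l j) * `|P i j| ^+ 2] in [0, 1] and total [\tr P],
   because [P i i = \sum_j `|P i j| ^+ 2]. *)
Lemma projector_offdiag_le P (l : 'I_d -> C) (k : nat) :
  projector P -> \tr P = k%:R -> (k <= d)%N ->
  (forall i, 0 <= l i <= 1) -> (forall i j : 'I_d, (i <= j)%N -> l j <= l i) ->
  \tr (P *m diag_mx (\row_i l i)) +
    \tr (P *m diag_mx (\row_i l i) *m (1%:M - P) *m diag_mx (\row_i l i)) <=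
  \sum_(i < d | (i < k)%N) l i.
Proof.
move=> pP trP kd l01 lmono; set D := diag_mx _.
pose w i j := P i j * P j i.
have w0 i j : 0 <= w i j by rewrite /w (projector_entry i j pP) mul_conjC_ge0.
have wC i j : w i j = w j i by rewrite /w mulrC.
have sw i : \sum_j w i j = P i i by exact: projector_row.
pose x i := P i i + \sum_j (l i - l j) * w i j.
have -> : \tr (P *m D) + \tr (P *m D *m (1%:M - P) *m D) = \sum_i l i * x i.
  rewrite /mxtrace -big_split/=; apply: eq_bigr => i _.
  rewrite !mul_mx_diag !mxE.
  have -> : x i = P i i + (l i * P i i - \sum_j l j * w i j).
    rewrite /x; congr (_ + _); under eq_bigr do rewrite mulrBl.
    by rewrite sumrB -mulr_sumr sw.
  have -> : \sum_j (\matrix_(i, j) (P i j * (\row_i l i) 0 j)) i j * (1%:M - P) j i =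
      l i * P i i - \sum_j l j * w i j.
    rewrite (eq_bigr (fun j => P i j * l j * (j == i)%:R - l j * w i j)); last first.
      by move=> j _; rewrite !mxE /w; ring.
    rewrite sumrB; congr (_ - _); rewrite (bigD1 i)//= eqxx mulr1 big1 ?addr0 1?mulrC//.
    by move=> j /negbTE ->; rewrite mulr0.
  by ring.
apply: sum_le_top => //; last first.
  (* The correction [(l i - l j) * w i j] is antisymmetric, so it does not change the total. *)
  rewrite /x big_split/= [X in _ + X](_ : _ = 0) ?addr0//.
  under eq_bigr do under eq_bigr do rewrite mulrBl.
  under eq_bigr do rewrite sumrB.
  rewrite sumrB [X in _ - X]exchange_big/= -sumrB big1// => i _.
  by rewrite -sumrB big1// => j _; rewrite wC subrr.
move=> i; apply/andP; split.
  rewrite /x -sw -big_split/=; apply: sumr_ge0 => j _.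
  rewrite -[X in X + _]mul1r -mulrDl mulr_ge0//.
  have /andP[li _] := l01 i; have /andP[_ lj] := l01 j.
  by rewrite addrCA addr_ge0// subr_ge0.
have hw : w i i = P i i ^+ 2 by rewrite /w expr2.
(* Bounding [l i - l j] by 1 for [j != i] gives [2 * P i i - P i i ^+ 2], which is
   [1 - (1 - P i i) ^+ 2]. *)
apply: (@le_trans _ _ (2 * P i i - P i i ^+ 2)); last first.
  have hPi : P i i \is Num.real by rewrite ger0_real// -sw sumr_ge0.
  rewrite -subr_ge0 (_ : _ - _ = (1 - P i i) ^+ 2); last by ring.
  by rewrite real_exprn_even_ge0// rpredB ?rpred1.
rewrite /x -hw (bigD1 i)//= subrr mul0r add0r.
rewrite (_ : 2 * P i i - w i i = P i i + \sum_(j | j != i) w i j); last first.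
  have -> : \sum_(j | j != i) w i j = P i i - w i i.
    by have := sw i; rewrite (bigD1 i)//= => <-; ring.
  by ring.
rewrite lerD2l; apply: ler_sum => j _; apply: ler_piMl => //.
have /andP[_ li] := l01 i; have /andP[lj _] := l01 j.
by rewrite lerBlDr (le_trans li)// lerDl.
Qed.

Lemma offdiag_expand P A B (x y x' y' : C) :
  \tr (P *m (x *: A + y *: B) *m (1%:M - P) *m (x' *: A + y' *: B)) =
  x * x' * \tr (P *m A *m (1%:M - P) *m A) + x * y' * \tr (P *m A *m (1%:M - P) *m B) +
  y * x' * \tr (P *m B *m (1%:M - P) *m A) + y * y' * \tr (P *m B *m (1%:M - P) *m B).
Proof.
rewrite !(mulmxDr, mulmxDl) -!scalemxAr -!scalemxAl !mxtraceD !mxtraceZ.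
ring.
Qed.

(** After expanding [1 - P], the two terms containing [P] twice cancel by cyclicity of the trace. *)
Lemma offdiag_commutator P A B :
  \tr (P *m A *m (1%:M - P) *m B) - \tr (P *m B *m (1%:M - P) *m A) =
  \tr (P *m (A *m B - B *m A)).
Proof.
rewrite !mulmxBr !mulmxBl !mulmx1 !raddfB/= -!mulmxA.
rewrite (_ : \tr (P *m (A *m (P *m B))) = \tr (P *m (B *m (P *m A)))); first by ring.
by rewrite !(mulmxA P) [LHS]mxtrace_mulC !mulmxA.
Qed.

Lemma trmxC_tr_ge0 (M : 'M[C]_d) : 0 <= \tr (M *m M^t*).
Proof.
apply: sumr_ge0 => i _; rewrite mxE; apply: sumr_ge0 => j _.
by rewrite !mxE mul_conjC_ge0.
Qed.

(* This is [0 <= |P (r A - 'i s B) P'| ^+ 2] with [P' = 1 - P]. *)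
Lemma commutator_trace_le P A B (r s : C) :
  projector P -> A^t* = A -> B^t* = B -> 0 <= r -> 0 <= s ->
  - (r * s * 'i * \tr (P *m (A *m B - B *m A))) <=
  r ^+ 2 * \tr (P *m A *m (1%:M - P) *m A) + s ^+ 2 * \tr (P *m B *m (1%:M - P) *m B).
Proof.
move=> [hP PP] hA hB r0 s0.
have rC : r^* = r by apply/CrealP/ger0_real.
have sC : s^* = s by apply/CrealP/ger0_real.
pose M := P *m (r *: A + (- ('i * s)) *: B) *m (1%:M - P).
have hM : M^t* = (1%:M - P) *m (r *: A + ('i * s) *: B) *m P.
  rewrite /M !trmxC_mul hP mulmxA; congr (_ *m _ *m _).
    by rewrite linearB/= map_mxB trmx1 map_mx1 hP.
  have adj (X : 'M[C]_d) (h : X^t* = X) i j : (X j i)^* = X i j by rewrite -[in RHS]h !mxE.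
  apply/matrixP => i j; rewrite !mxE rmorphD !rmorphM rmorphN rmorphM/= conjCi rC sC !adj//.
  by ring.
have QQ : (1%:M - P) *m (1%:M - P) = 1%:M - P.
  by rewrite mulmxBr mulmx1 mulmxBl mul1mx PP subrr subr0.
have := trmxC_tr_ge0 M; rewrite hM /M.
rewrite !mulmxA -(mulmxA _ (1%:M - P) (1%:M - P)) QQ mxtrace_mulC !mulmxA PP.
rewrite offdiag_expand.
have := offdiag_commutator P A B.
set t1 := \tr (P *m A *m (1%:M - P) *m B); set t2 := \tr (P *m B *m (1%:M - P) *m A) => <-.
set t3 := \tr _; set t4 := \tr _ => h; rewrite -subr_ge0; apply: le_trans h _.
rewrite le_eqVlt; apply/orP; left; apply/eqP.
have -> : - ('i * s) * ('i * s) = s ^+ 2 by rewrite -[RHS]mul1r -[1]opprK -sqrCi; ring.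
ring.
Qed.

End Projector.

(** * Majorization *)

Lemma exists_sorting_perm {R : realDomainType} {d : nat} (l : 'I_d -> R) :
  exists s : {perm 'I_d}, forall i j : 'I_d, (i <= j)%N -> l (s j) <= l (s i).
Proof.
pose le i j := l j <= l i.
have tle : total le by move=> i j; exact: le_total.
have trle : transitive le by move=> j i k h1 h2; exact: le_trans h1.
have /tuple_permP[s hs] : perm_eq (sort_tuple le (ord_tuple d)) (ord_tuple d).
  by rewrite perm_sort.
exists s => i j ij.
have st := sort_sorted tle (ord_tuple d).
have rle : reflexive le by move=> k; exact: lexx.
have := sorted_leq_nth trle rle i st i j; rewrite !inE.
have -> : sort le (ord_tuple d) = sort_tuple le (ord_tuple d) by [].
rewrite size_tuple !ltn_ord => /(_ isT isT ij).
by rewrite hs -!tnth_nth !tnth_mktuple !tnth_ord_tuple.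
Qed.

(** Summation by parts: at each step the factor of a nonnegative partial sum is lowered from [f n]
    to [f n.+1]. *)
Lemma abel_sum_ge {R : realDomainType} (f e : nat -> R) (n : nat) :
  (forall i, (i < n)%N -> f i.+1 <= f i) ->
  (forall k, (k <= n)%N -> 0 <= \sum_(i < k) e i) ->
  f n * \sum_(i < n.+1) e i <= \sum_(i < n.+1) f i * e i.
Proof.
elim: n => [|n IH] hf he; first by rewrite !big_ord1.
rewrite big_ord_recr [leRHS]big_ord_recr/= mulrDr lerD2r.
apply: le_trans (IH _ _) => [|i|k kn].
- by apply: ler_wpM2r; [exact: he | exact: hf].
- by move=> ni; apply: hf; exact: ltnW.
- by apply: he; exact: leqW.
Qed.

Lemma ord_abel_sum_ge0 {R : realDomainType} {d : nat} (f e : 'I_d -> R) :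
  (forall i j : 'I_d, (i <= j)%N -> f j <= f i) ->
  (forall k, (k <= d)%N -> 0 <= \sum_(i < d | (i < k)%N) e i) ->
  \sum_i e i = 0 -> 0 <= \sum_i f i * e i.
Proof.
case: d f e => [|d] f e hf he e0; first by rewrite big_ord0.
have hI (g : 'I_d.+1 -> R) : \sum_i g i = \sum_(i < d.+1) g (inord i).
  by apply: eq_bigr => i _; rewrite inord_val.
have hk (k : nat) : (k <= d.+1)%N ->
    \sum_(i < d.+1 | (i < k)%N) e i = \sum_(i < k) e (inord i).
  move=> kd; rewrite (big_ord_widen _ (fun i => e (inord i)) kd).
  by apply: eq_bigr => i _; rewrite inord_val.
have := @abel_sum_ge R (fun i => f (inord i)) (fun i => e (inord i)) d.
rewrite -!hI -(hI (fun i => f i * e i)) e0 mulr0; apply.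
- by move=> i id; apply: hf; rewrite !inordK ?ltnS// ltnW.
- by move=> k kd; rewrite -hk ?leqW//; apply: he; exact: leqW.
Qed.

(** Gibbs' inequality replaces [ln (p i)] by [ln (q i)] in the entropy of [p]; as [ln (q i)]
    decreases with [i], summation by parts against [p i - q i] then replaces the weights [p] by
    [q]. *)
Lemma shannon_schur_concave {R : realType} {d : nat} (p q : 'I_d -> R) : prob p ->
  (forall i j : 'I_d, (i <= j)%N -> q j <= q i) -> \sum_i q i = 1 ->
  (forall k, (k <= d)%N -> \sum_(i < d | (i < k)%N) q i <= \sum_(i < d | (i < k)%N) p i) ->
  shannon p <= shannon q.
Proof.
move=> [p0 p1] qmono q1 maj.
have tail (g : 'I_d -> R) (i : 'I_d) : \sum_j g j =
    \sum_(j < d | (j < i)%N) g j + \sum_(j < d | (i <= j)%N) g j.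
  rewrite (bigID (fun j : 'I_d => (j < i)%N))/=; congr (_ + _).
  by apply: eq_bigl => j; rewrite -leqNgt.
have htail (i : 'I_d) : \sum_(j < d | (i <= j)%N) p j <= \sum_(j < d | (i <= j)%N) q j.
  have := maj i (ltnW (ltn_ord i)); have := tail p i; have := tail q i.
  by rewrite q1 p1; lra.
have q0 i : 0 <= q i.
  have lt : (d.-1 < d)%N by case: (d) i => [[]//|].
  pose m := Ordinal lt.
  have im : (i <= m)%N by rewrite /= -ltnS prednK// (leq_ltn_trans _ (ltn_ord i)).
  apply: le_trans (qmono _ _ im); apply: le_trans (p0 m) _.
  have := htail m; rewrite !(big_pred1 m)// => j; apply/idP/eqP => [mj|->//].
    apply/val_inj/eqP; rewrite eqn_leq mj andbT/= -ltnS prednK// ?ltn_ord//.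
    exact: leq_ltn_trans (ltn_ord i).
  by apply/val_inj/eqP; rewrite eqn_leq mj andbT/= -ltnS prednK// (leq_ltn_trans _ (ltn_ord i)).
have qp i : q i = 0 -> p i = 0.
  move=> qi; have : \sum_(j < d | (i <= j)%N) q j = 0.
    apply: big1 => j ij; apply/le_anti; rewrite q0 andbT -qi; exact: qmono.
  have := htail i; rewrite (bigD1 i)//= => h e; apply/le_anti; rewrite p0 andbT -e.
  by apply: le_trans h; rewrite lerDl sumr_ge0.
(* The default [ln 0 = 0] would break monotonicity where [q] vanishes. There [- M], below all
   [ln (q j)], is used instead, harmlessly since [p] vanishes there too. *)
pose M := \sum_j `|ln (q j)|.
pose f i := if 0 < q i then ln (q i) else - M.
have fM i : - M <= ln (q i).
  rewrite lerNl (le_trans (ler_norm _))// normrN /M (bigD1 i)//= lerDl.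
  by apply: sumr_ge0.
have : 0 <= \sum_i f i * (p i - q i).
  apply: ord_abel_sum_ge0 => [i j ij|k kd|].
  - rewrite /f; case: (ltP 0 (q j)) => [qj|qj].
      have qi := lt_le_trans qj (qmono _ _ ij).
      by rewrite qi ler_ln ?posrE// qmono.
    by case: ifP.
  - by rewrite sumrB subr_ge0 maj.
  - by rewrite sumrB p1 q1 subrr.
have -> : \sum_i f i * (p i - q i) = \sum_i p i * ln (q i) - \sum_i q i * ln (q i).
  rewrite -sumrB; apply: eq_bigr => i _; rewrite /f lt_def q0 andbT.
  have [e|_] /= := eqVneq (q i) 0; first by rewrite e (qp _ e); ring.
  by ring.
(* Adding [p i - q i], of total 0, makes the inequality hold termwise. *)
have klein : \sum_i p i * ln (q i) <= \sum_i p i * ln (p i).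
  have -> : \sum_i p i * ln (q i) = \sum_i (p i * ln (q i) + (p i - q i)).
    by rewrite big_split/= sumrB p1 q1 subrr addr0.
  apply: ler_sum => i _; have [e|pn0] := eqVneq (p i) 0.
    by rewrite e !mul0r !add0r oppr_le0.
  have pi0 : 0 < p i by rewrite lt_def pn0 p0.
  have qi0 : 0 < q i.
    by rewrite lt_def q0 andbT; apply: contra_neq pn0; exact: qp.
  have : ln (1 + (q i / p i - 1)) <= q i / p i - 1.
    by apply: le_ln1Dx; have := divr_gt0 qi0 pi0; lra.
  rewrite addrCA subrr addr0 ln_div ?posrE// => /(ler_wpM2l (p0 i)).
  rewrite mulrBr mulrBr mulr1 (mulrC (p i) (q i / _)) divfK//; lra.
by rewrite /shannon lerN2 subr_ge0 => h; exact: le_trans klein.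
Qed.

(** * The addition rule *)

Section KyFan.
Local Open Scope sesquilinear_scope.
Context {C : numClosedFieldType} {d : nat}.
Implicit Types A B P U V : 'M[C]_d.

Lemma row_perm_unitary (s : {perm 'I_d}) U : U \is unitarymx -> row_perm s U \is unitarymx.
Proof.
move=> /unitarymxP hU; apply/unitarymxP/matrixP => i j.
have := congr1 (fun M : 'M[C]_d => M (s i) (s j)) hU; rewrite !mxE (inj_eq perm_inj) => <-.
by apply: eq_bigr => k _; rewrite !mxE.
Qed.

Lemma unitary_diag_perm (s : {perm 'I_d}) U (l : 'I_d -> C) :
  (row_perm s U)^t* *m diag_mx (\row_i l (s i)) *m row_perm s U =
  U^t* *m diag_mx (\row_i l i) *m U.
Proof.
apply/matrixP => i j; rewrite !mxE [RHS](reindex_inj (@perm_inj _ s))/=.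
by apply: eq_bigr => k _; rewrite !mul_mx_diag !mxE.
Qed.

(** The diagonal case for the projector [V *m P *m V^t*]. It strengthens Ky Fan's bound on
    [\tr (P *m A)] by an off-diagonal term. *)
Lemma projector_trace_le P V (l : 'I_d -> C) (k : nat) :
  V \is unitarymx -> projector P -> \tr P = k%:R -> (k <= d)%N ->
  (forall i, 0 <= l i <= 1) -> (forall i j : 'I_d, (i <= j)%N -> l j <= l i) ->
  let A := V^t* *m diag_mx (\row_i l i) *m V in
  (\tr (P *m A) + \tr (P *m A *m (1%:M - P) *m A) <= \sum_(i < d | (i < k)%N) l i : Prop).
Proof.
move=> hV pP trP kd l01 lmono A; have [pQ trQ] := projector_conj hV pP.
have := projector_offdiag_le pQ (etrans trQ trP) kd l01 lmono.
have VV := unitarymxP hV; have V'V := mulmx1C VV.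
set D := diag_mx _ => h; apply: le_trans h; rewrite le_eqVlt; apply/orP; left; apply/eqP.
have QE : 1%:M - V *m P *m V^t* = V *m (1%:M - P) *m V^t*.
  by rewrite mulmxBr mulmxBl mulmx1 VV.
rewrite QE /A; congr (_ + _).
  by rewrite !mulmxA mxtrace_mulC !mulmxA.
by rewrite !mulmxA mxtrace_mulC !mulmxA.
Qed.

Lemma spectral_projector U (k : nat) : U \is unitarymx -> (k <= d)%N ->
  let P := U^t* *m diag_mx (\row_i (i < k)%N%:R) *m U in
  [/\ projector P, \tr P = k%:R &
    forall l : 'I_d -> C, \tr (P *m (U^t* *m diag_mx (\row_i l i) *m U)) =
      \sum_(i < d | (i < k)%N) l i].
Proof.
move=> hU kd P; pose E : 'M[C]_d := diag_mx (\row_i (i < k)%N%:R).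
have UU := unitarymxP hU; have U'U := mulmx1C UU.
have pE : projector E.
  split; first by apply/matrixP => i j; rewrite !mxE eq_sym rmorphMn/= conjC_nat; case: eqP => [->|].
  by rewrite mulmx_diag; congr diag_mx; apply/rowP => i; rewrite !mxE -natrM mulnb andbb.
have hU' : U^t* \is unitarymx by rewrite trmxC_unitary.
have [] := projector_conj hU' pE; rewrite trmxCK => pP trP.
split=> //.
  by rewrite [LHS]trP mxtrace_diag -[RHS](@sum_indicator_lt _ d)//; apply: eq_bigr => i _; rewrite mxE.
move=> l; rewrite /P -!mulmxA (mulmxA U) UU mul1mx mxtrace_mulC -!mulmxA UU mulmx1.
rewrite mulmx_diag mxtrace_diag [RHS]big_mkcond; apply: eq_bigr => i _.
by rewrite !mxE; case: ltnP => _; rewrite ?mul1r ?mul0r.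
Qed.

End KyFan.

Section Qadd.
Local Open Scope sesquilinear_scope.
Context {R : realType} {d : nat}.
Local Notation C := (R[i]).
Implicit Types A B : 'M[C]_d.

(** Majorization concerns ordered spectra, and [spectral_diag] is not known to be sorted; hence a
    relation with its own diagonalizing unitary. *)
Definition spectrum_of A (l : 'I_d -> R) :=
  (forall i j : 'I_d, (i <= j)%N -> l j <= l i) /\
  exists2 U : 'M[C]_d, U \is unitarymx & A = U^t* *m diag_mx (\row_i (l i)%:C%C) *m U.

Lemma hermitian_spectrum A : A \is hermsymmx ->
  exists l, spectrum_of A l /\ entropy A = shannon l.
Proof.
move=> /spectral_decomp[U [l [hU hA ->]]].
have [s hs] := exists_sorting_perm l.
exists (fun i => l (s i)); split; last first.
  by rewrite /shannon [in LHS](reindex_inj (@perm_inj _ s)).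
split=> //; exists (row_perm s U); first exact: row_perm_unitary.
by rewrite hA (unitary_diag_perm s U (fun i => (l i)%:C%C)).
Qed.

Lemma spectrum_trace A l : spectrum_of A l -> \tr A = (\sum_i l i)%:C%C.
Proof.
move=> [_ [U /unitarymxP hU ->]].
rewrite mxtrace_mulC mulmxA hU mul1mx mxtrace_diag rmorph_sum.
by apply: eq_bigr => i _; rewrite mxE.
Qed.

Lemma density_spectrum A l : density A -> spectrum_of A l -> prob l.
Proof.
move=> [[_ psd] trA] /[dup] sA [_ [U /unitarymxP hU hA]]; split=> [i|]; last first.
  by apply: complexI; rewrite -(spectrum_trace sA) trA.
(* The quadratic form at the [i]-th eigenvector is [l i]. *)
have := psd (U^t* *m delta_mx i 0); rewrite hA trmxC_mul trmxCK.
rewrite !mulmxA -(mulmxA _ U (U^t*)) hU mulmx1 -(mulmxA _ U (U^t*)) hU mulmx1.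
rewrite -colE mul_mx_diag !mxE !eqxx conjC1 mul1r.
by rewrite -(rmorph0 (real_complex R)) lecR.
Qed.

Lemma sum_complexR (P : pred 'I_d) (f : 'I_d -> R) :
  \sum_(i < d | P i) (f i)%:C%C = (\sum_(i < d | P i) f i)%:C%C.
Proof. by rewrite rmorph_sum. Qed.

Lemma hermsymmxP A : A \is hermsymmx <-> A^t* = A.
Proof.
split=> [/is_hermitianmxP|h]; first by rewrite expr0 scale1r.
by apply/is_hermitianmxP; rewrite expr0 scale1r.
Qed.

Lemma qadd_hermitian (a : R) A B : A \is hermsymmx -> B \is hermsymmx ->
  qadd a A B \is hermsymmx.
Proof.
move=> /hermsymmxP hA /hermsymmxP hB; apply/hermsymmxP.
have adj (X : 'M[C]_d) (h : X^t* = X) i j : (X j i)^* = X i j by rewrite -[in RHS]h !mxE.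
have cR (x : R) : ((x%:C%C : C)^*) = x%:C%C.
  by apply/CrealP/complex_realP; exists x.
have hc i j : (commutator A B j i)^* = - commutator A B i j.
  rewrite /commutator !mxE rmorphB !rmorph_sum opprB /=; congr (_ - _).
    by apply: eq_bigr => k _; rewrite rmorphM/= !adj// mulrC.
  by apply: eq_bigr => k _; rewrite rmorphM/= !adj// mulrC.
have qE i j : qadd a A B i j = a%:C%C * A i j + (1 - a)%:C%C * B i j -
    (Num.sqrt (a * (1 - a)))%:C%C * 'i * commutator A B i j.
  by rewrite /qadd complexiE 7!mxE.
apply/matrixP => i j; rewrite 2!mxE !qE rmorphB rmorphD !rmorphM/= conjCi !cR hc !adj//.
by ring.
Qed.

Lemma mxtraceB A B : \tr (A - B) = \tr A - \tr B.
Proof. exact: raddfB. Qed.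

Lemma qadd_trace (a : R) A B : \tr A = 1 -> \tr B = 1 -> \tr (qadd a A B) = 1.
Proof.
move=> hA hB; rewrite /qadd /commutator mxtraceB mxtraceD !mxtraceZ mxtraceB hA hB.
by rewrite (mxtrace_mulC B) subrr mulr0 subr0 !mulr1 -rmorphD/= addrC subrK.
Qed.

(** The left-hand side is the trace of the sum against the projector [P] on its [k] leading
    eigenvectors. By [commutator_trace_le] with [r], [s] the square roots of [a], [1 - a], the
    commutator adds at most the off-diagonal terms that [projector_trace_le] leaves room for in [A]
    and [B]. *)
Lemma qadd_majorized (a : R) A B lA lB mu (k : nat) : 0 <= a <= 1 ->
  A \is hermsymmx -> B \is hermsymmx ->
  spectrum_of A lA -> spectrum_of B lB -> prob lA -> prob lB ->
  spectrum_of (qadd a A B) mu -> (k <= d)%N ->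
  \sum_(i < d | (i < k)%N) mu i <=
  \sum_(i < d | (i < k)%N) (a * lA i + (1 - a) * lB i).
Proof.
move=> /andP[a0 a1] /hermsymmxP hA /hermsymmxP hB sA sB pA pB [_ [U hU hq]] kd.
have b0 : 0 <= 1 - a by rewrite subr_ge0.
pose P : 'M[C]_d := U^t* *m diag_mx (\row_i (i < k)%N%:R) *m U.
have [pP trP trq] : [/\ projector P, \tr P = k%:R & forall l : 'I_d -> C,
    \tr (P *m (U^t* *m diag_mx (\row_i l i) *m U)) = \sum_(i < d | (i < k)%N) l i].
  exact: spectral_projector.
have bound X l : spectrum_of X l -> prob l ->
    \tr (P *m X) + \tr (P *m X *m (1%:M - P) *m X) <= (\sum_(i < d | (i < k)%N) l i)%:C%C.
  move=> [lmono [V hV hX]] pl.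
  rewrite -sum_complexR hX; apply: (projector_trace_le hV pP trP kd) => [i|i j ij].
    by rewrite -(rmorph0 (real_complex R)) -(rmorph1 (real_complex R)) !lecR pl.1 prob_le1.
  by rewrite lecR lmono.
have {}sA := bound _ _ sA pA; have {}sB := bound _ _ sB pB.
have := trq (fun i => (mu i)%:C%C); rewrite -hq sum_complexR => {}trq.
rewrite big_split/= -!mulr_sumr -lecR -trq.
pose r : C := (Num.sqrt a)%:C%C; pose s : C := (Num.sqrt (1 - a))%:C%C.
have r0 : 0 <= r by rewrite -(rmorph0 (real_complex R)) lecR sqrtr_ge0.
have s0 : 0 <= s by rewrite -(rmorph0 (real_complex R)) lecR sqrtr_ge0.
have ra : r ^+ 2 = a%:C%C by rewrite -rmorphXn/= sqr_sqrtr.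
have sa : s ^+ 2 = (1 - a)%:C%C by rewrite -rmorphXn/= sqr_sqrtr.
have -> : \tr (P *m qadd a A B) = r ^+ 2 * \tr (P *m A) + s ^+ 2 * \tr (P *m B)
    - r * s * 'i * \tr (P *m (A *m B - B *m A)).
  rewrite /qadd /commutator complexiE sqrtrM// rmorphM/= -/r -/s -ra -sa.
  move: (A *m B - B *m A) => X.
  by rewrite mulmxBr mulmxDr mxtraceB mxtraceD -!scalemxAr !mxtraceZ.
rewrite rmorphD !rmorphM/= -ra -sa.
have := commutator_trace_le pP hA hB r0 s0.
have : r ^+ 2 * (\tr (P *m A) + \tr (P *m A *m (1%:M - P) *m A)) <=
  r ^+ 2 * (\sum_(i < d | (i < k)%N) lA i)%:C%C by rewrite ler_wpM2l// exprn_ge0.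
have : s ^+ 2 * (\tr (P *m B) + \tr (P *m B *m (1%:M - P) *m B)) <=
  s ^+ 2 * (\sum_(i < d | (i < k)%N) lB i)%:C%C by rewrite ler_wpM2l// exprn_ge0.
move: (\tr (P *m A)) (\tr (P *m B)) (\tr (P *m A *m _ *m A)) (\tr (P *m B *m _ *m B))
  (\tr (P *m (_ - _))) (_%:C%C) (_%:C%C) => t1 t2 t3 t4 t5 t6 t7.
move=> h1 h2 h3; have := lerD (lerD h2 h1) h3.
rewrite -subr_ge0 => h; rewrite -subr_ge0; apply: le_trans h _.
by rewrite le_eqVlt; apply/orP; left; apply/eqP; ring.
Qed.

(** This separates matrices from analysis: concavity on the simplex and monotonicity in the entropy
    are all that remains. *)
Lemma qadd_entropy_ge (a : R) A B : 0 <= a <= 1 -> density A -> density B ->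
  exists p q : 'I_d -> R, [/\ prob p /\ prob q, entropy A = shannon p,
    entropy B = shannon q &
    shannon (fun i => a * p i + (1 - a) * q i) <= entropy (qadd a A B)].
Proof.
move=> a01 dA dB; have [[hA _] tA] := dA; have [[hB _] tB] := dB.
have [p [sp ep]] := hermitian_spectrum hA; have [q [sq eq]] := hermitian_spectrum hB.
have pp := density_spectrum dA sp; have pq := density_spectrum dB sq.
exists p, q; split=> //.
have hq := qadd_hermitian a hA hB.
have [mu [smu ->]] := hermitian_spectrum hq.
apply: shannon_schur_concave; first exact: prob_conv.
- exact: smu.1.
- by apply: complexI; rewrite -(spectrum_trace smu) qadd_trace.
- by move=> k kd; exact: (qadd_majorized a01 hA hB sp sq pp pq smu kd).
Qed.

End Qadd.

(** * Concavity of the entropy and of its exponential on the simplex *)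

Section Concavity.
Context {R : realType} {d : nat}.
Implicit Types p q : 'I_d -> R.

Lemma shannon_concave p q (a : R) : prob p -> prob q -> 0 <= a <= 1 ->
  a * shannon p + (1 - a) * shannon q <= shannon (fun i => a * p i + (1 - a) * q i).
Proof.
move=> pp pq a01.
apply: (@shannon_comp_concave R d id (cst 1) (cst 0) p q a) => //.
- by move=> x; exact: cvg_id.
- by move=> r _ _; rewrite mul0r.
Qed.

(** For [phi x = expR (c * x)] the condition [phi2 * V <= phi1] follows from [c * V <= 1], hence
    from the bound [ln d ^+ 2] on the varentropy. *)
Lemma expR_shannon_concave p q (a c : R) : (2 <= d)%N -> prob p -> prob q ->
  0 <= a <= 1 -> 0 <= c <= 1 / ln d%:R ^+ 2 ->
  a * expR (c * shannon p) + (1 - a) * expR (c * shannon q) <=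
  expR (c * shannon (fun i => a * p i + (1 - a) * q i)).
Proof.
move=> d2 pp pq a01 /andP[c0 c1].
have de (x : R) : is_derive x 1 (fun y => expR (c * y)) (expR (c * x) * c).
  exact: (@is_derive1_comp _ expR (fun y => c * y) _ _ _ (is_derive_expR _) (mull_derive c x)).
have dec (x : R) : is_derive x 1 (fun y => expR (c * y) * c) (expR (c * x) * c * c).
  have h := is_deriveM (de x) (is_derive_cst c x (1 : R)).
  by apply: (is_derive_eq h); rewrite /GRing.scale/= mulr0 add0r mulrC.
apply: (@shannon_comp_concave R d _ _ (fun x => expR (c * x) * c * c) p q a _
  (fun x _ => de x) (fun x _ => dec x)) => //.
- by move=> x; apply: differentiable_continuous; apply/derivable1_diffP; case: (de x).
- by move=> x _; rewrite mulr_ge0 ?expR_ge0.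
- move=> r pr _; rewrite -[leRHS]mulr1 -[leLHS]mulrA.
  apply: ler_wpM2l; first by rewrite mulr_ge0 ?expR_ge0.
  have l0 : 0 < ln d%:R ^+ 2 :> R by rewrite exprn_gt0// ln_gt0// ltr1n.
  apply: le_trans (ler_wpM2l c0 (varentropy_le_ln_sqr d2 pr)) _.
  by rewrite -ler_pdivlMr.
Qed.

End Concavity.

Lemma ginv_le {R : realType} (x y : R) : 0 <= x -> x <= y -> ginv x <= ginv y.
Proof.
move=> x0 xy; have y0 := le_trans x0 xy; rewrite leNgt; apply/negP => h.
by have := gfun_lt (ginv_ge0 y0) h; rewrite !ginvK// ltNge xy.
Qed.

Unset Implicit Arguments.

Theorem corollary7 (R : realType) (d : nat) (hd : (2 <= d)%N)
    (rho sigma : 'M[R[i]]_d) (hrho : density rho) (hsigma : density sigma)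
    (a : R) (ha : 0 <= a <= 1) :
  [/\ entropy (qadd a rho sigma) >= a * entropy rho + (1 - a) * entropy sigma,
      forall c : R, 0 <= c <= 1 / (ln (d%:R : R)) ^+ 2 ->
        expR (c * entropy (qadd a rho sigma)) >=
        a * expR (c * entropy rho) + (1 - a) * expR (c * entropy sigma)
    & forall c : R, 0 <= c <= 1 / (d%:R - 1) ->
        photon_number c (qadd a rho sigma) >=
        a * photon_number c rho + (1 - a) * photon_number c sigma].
Proof.
have [p [q [[pp pq] ep eq hle]]] := qadd_entropy_ge ha hrho hsigma.
rewrite /photon_number ep eq; split=> [|c hc|c hc].
- exact: le_trans (shannon_concave pp pq ha) hle.
- apply: le_trans (expR_shannon_concave hd pp pq ha hc) _.
  by rewrite ler_expR ler_wpM2l//; case/andP: hc.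
- apply: le_trans (photon_number_concave hd pp pq ha hc) _.
  have /andP[c0 _] := hc.
  by apply: ginv_le; rewrite ?ler_wpM2l// mulr_ge0// shannon_ge0//; exact: prob_conv.
Qed.
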